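(* We have $$\varphi(e^{-7\pi\sqrt{7}}) = 7^{-3/4}\,\varphi(e^{-\pi\sqrt{7}})\left\{1 + \left(\frac{\cos\frac{\pi}{7}}{2\cos^2\frac{2\pi}{7}}\right)^{2/7} + \left(\frac{\cos\frac{2\pi}{7}}{2\cos^2\frac{3\pi}{7}}\right)^{2/7} + \left(\frac{\cos\frac{3\pi}{7}}{2\cos^2\frac{\pi}{7}}\right)^{2/7}\right\}.$$
   Context: For $|q|<1$, Ramanujan's theta function is $\varphi(q) := \sum_{n=-\infty}^{\infty} q^{n^2}$. Fractional powers of positive real numbers are the positive real ones. *)

(* Defs.v *)
From Stdlib Require Import Reals ZArith Lra Lia.
From Coquelicot Require Import Coquelicot.
Open Scope R_scope.

(* The sum of a over all integers, as the sum over n >= 0 plus the sum over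
   n <= -1.  Meaningful when both halves converge. *)
Definition bilateral_series (a : Z -> R) : R :=
  Series (fun n : nat => a (Z.of_nat n))
  + Series (fun n : nat => a (- Z.of_nat (S n))%Z).

Definition ex_bilateral_series (a : Z -> R) : Prop :=
  ex_series (fun n : nat => a (Z.of_nat n))
  /\ ex_series (fun n : nat => a (- Z.of_nat (S n))%Z).

(* Ramanujan's theta function for a real nome q with |q| < 1.  The exponent
   n ^ 2 is never negative, so powerRZ is an ordinary power here, with value 1
   for n = 0 even when q = 0. *)
Definition varphi (q : R) : R :=
  bilateral_series (fun n : Z => powerRZ q (n ^ 2)%Z).

Lemma powerRZ_sqr (q : R) (n : nat) :
  powerRZ q (Z.of_nat n ^ 2)%Z = q ^ (n * n).
Proof.
  replace (Z.of_nat n ^ 2)%Z with (Z.of_nat (n * n)) by lia.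
  symmetry; apply pow_powerRZ.
Qed.

Lemma pow_le_of_le_1 (x : R) (m n : nat) :
  0 <= x <= 1 -> (m <= n)%nat -> x ^ n <= x ^ m.
Proof.
  intros Hx Hmn.
  replace n with (m + (n - m))%nat by lia.
  rewrite pow_add.
  assert (H1 : 0 <= x ^ m) by (apply pow_le; lra).
  assert (H2 : x ^ (n - m) <= 1).
  { rewrite <- (pow1 (n - m)); apply pow_incr; lra. }
  nra.
Qed.

Lemma ex_varphi (q : R) :
  Rabs q < 1 -> ex_bilateral_series (fun n : Z => powerRZ q (n ^ 2)%Z).
Proof.
  intros Hq.
  assert (Hg : ex_series (fun n : nat => Rabs q ^ n)).
  { apply ex_series_geom; rewrite Rabs_Rabsolu; exact Hq. }
  assert (Hb : forall m n : nat, (n <= m)%nat -> Rabs (q ^ m) <= Rabs q ^ n).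
  { intros m n Hmn; rewrite <- RPow_abs; apply pow_le_of_le_1; [|exact Hmn].
    split; [apply Rabs_pos | lra]. }
  split; apply (@ex_series_le R_AbsRing R_CompleteNormedModule _
                  (fun n => Rabs q ^ n)); try exact Hg; intros n.
  - change (Rabs (powerRZ q (Z.of_nat n ^ 2)%Z) <= Rabs q ^ n).
    rewrite powerRZ_sqr; apply Hb; nia.
  - change (Rabs (powerRZ q ((- Z.of_nat (S n)) ^ 2)%Z) <= Rabs q ^ n).
    replace ((- Z.of_nat (S n)) ^ 2)%Z with (Z.of_nat (S n) ^ 2)%Z by lia.
    rewrite powerRZ_sqr; apply Hb; nia.
Qed.

(* Main.v *)
Require Import Defs.
From Stdlib Require Import Reals ZArith Lra Lia.
From Coquelicot Require Import Coquelicot.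
Open Scope R_scope.

(* Put theta x = sum_n exp (- pi sqrt 7 (n + x)^2) and T_r = theta (r / 7).  The
   inversion formula gives
     varphi (exp (- 7 pi sqrt 7)) = 7^(-3/4) (T_0 + 2 T_1 + 2 T_2 + 2 T_3),
   while varphi (exp (- pi sqrt 7)) = T_0, so the ratios T_r / T_0 are wanted.

   Let z(x) = sum_n i^(n^2) exp (- pi sqrt 7 (n + x)^2 / 2), a theta value of
   modulus alpha = (1 + sqrt (-7)) / 2.  Rotating the lattice of the double sum
   gives theta x theta y = Re (z(x + y) conj (z(x - y))), in particular
   T_r T_0 = |z(r / 7)|^2.  Since alpha has norm 2 and -1/alpha = (alpha - 1)/2,
   Poisson summation followed by a Landen transformation compares z at two
   7-division points up to a real factor: z(8s/7) / z(2s/7) is a real multiple of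
   (-1)^s exp (- 4 pi i s^2 / 7).  Hence, for s = 1, 2, 3,
     T_2 T_3^2 = cos^2 (3 pi/7) T_1 T_0^2,   T_3 T_1^2 = cos^2 (2 pi/7) T_2 T_0^2,
     T_1 T_2^2 = cos^2 (pi/7) T_3 T_0^2,
   a system which is linear in the logarithms of the T_r / T_0. *)

(** * Sums over the integers *)

(** In theta x theta y = Re (...) the odd sublattice drops out because its terms are purely
    imaginary. With x + y = 8s/7 and x - y = 2s/7, that is x = 5s/7 and y = 3s/7, the known argument
    of z(8s/7) / z(2s/7) becomes a cosine. Squaring then trades the unknown real factor for
    |z(8s/7)|^2 and |z(2s/7)|^2, which are again products of theta values. As 5s = -2s modulo 7, one
    theta value cancels; as 8s = s, only T_0, ..., T_3 occur.

    The complex Gaussian integral in the Poisson formula is never evaluated: comparison with the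
    division point 0 eliminates it. Only the real Gaussian integral is computed, from Poisson
    summation at the self-dual parameter.

    The analysis stays over the reals. Poisson summation rests on a uniqueness argument for cosine
    coefficients, and shifting a contour is replaced by differentiation in a parameter. *)

Fixpoint zpart (f : Z -> R) (N : nat) : R :=
  match N with
  | O => 0
  | S N => zpart f N + (f (Z.of_nat N) + f (- Z.of_nat (S N))%Z)
  end.

(** One decay rate serves for all sums: Gaussian terms satisfy it, translations and affine
    reindexings change only [M], and tails are geometric. *)
Definition zbound (M : R) (f : Z -> R) : Prop :=
  forall n : Z, Rabs (f n) <= M * exp (- Rabs (IZR n)).

Definition zdec (f : Z -> R) : Prop := exists M : R, zbound M f.

Lemma exp_opp_INR (n : nat) : exp (- INR n) = exp (- 1) ^ n.
Proof.
  induction n as [|n IH]; [simpl; rewrite Ropp_0; apply exp_0|].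
  rewrite S_INR; simpl; rewrite <- IH, <- exp_plus; f_equal; ring.
Qed.

Lemma exp_opp_1_bound : 0 < exp (- 1) <= 1 / 2.
Proof.
  split; [apply exp_pos|].
  assert (H := exp_ineq1_le 1).
  replace (- 1) with (- (1)) by lra; rewrite exp_Ropp.
  replace (1 / 2) with (/ 2) by lra. apply Rinv_le_contravar; lra.
Qed.

Lemma Rabs_IZR_nat (n : nat) : Rabs (IZR (Z.of_nat n)) = INR n.
Proof. rewrite <- INR_IZR_INZ; apply Rabs_pos_eq, pos_INR. Qed.

Lemma Rabs_IZR_opp_nat (n : nat) : Rabs (IZR (- Z.of_nat n)) = INR n.
Proof. rewrite opp_IZR, Rabs_Ropp; apply Rabs_IZR_nat. Qed.

Lemma zbound_nonneg (M : R) (f : Z -> R) : zbound M f -> 0 <= M.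
Proof.
  intros H; specialize (H 0%Z); rewrite Rabs_R0, Ropp_0, exp_0 in H.
  assert (H0 := Rabs_pos (f 0%Z)); lra.
Qed.

Lemma zbound_term (M : R) (f : Z -> R) (n : nat) : zbound M f ->
  Rabs (f (Z.of_nat n)) <= M * exp (- 1) ^ n /\
  Rabs (f (- Z.of_nat (S n))%Z) <= M * exp (- 1) ^ n.
Proof.
  intros H; split.
  - rewrite <- exp_opp_INR, <- Rabs_IZR_nat; apply H.
  - eapply Rle_trans; [apply H|]; rewrite Rabs_IZR_opp_nat, exp_opp_INR.
    apply Rmult_le_compat_l; [exact (zbound_nonneg _ _ H)|].
    apply pow_le_of_le_1; [|lia]. destruct exp_opp_1_bound; lra.
Qed.

Lemma zdec_ex (f : Z -> R) : zdec f -> ex_bilateral_series f.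
Proof.
  intros [M H].
  assert (Hg : ex_series (fun n => M * exp (- 1) ^ n)).
  { apply (@ex_series_scal R_AbsRing R_NormedModule M (fun n => exp (- 1) ^ n)), ex_series_geom.
    destruct exp_opp_1_bound; rewrite Rabs_pos_eq; lra. }
  split; apply (@ex_series_le R_AbsRing R_CompleteNormedModule _
                  (fun n => M * exp (- 1) ^ n)); try exact Hg;
    intros n; apply (zbound_term M f n H).
Qed.

Lemma sum_n_zpart (f : Z -> R) (N : nat) :
  sum_n (fun n => f (Z.of_nat n) + f (- Z.of_nat (S n))%Z) N = zpart f (S N).
Proof.
  induction N as [|N IH].
  - rewrite sum_O; simpl; ring.
  - rewrite sum_Sn, IH; reflexivity.
Qed.

Lemma zpart_lim (f : Z -> R) : zdec f ->
  is_lim_seq (zpart f) (bilateral_series f).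
Proof.
  intros H; destruct (zdec_ex f H) as [H1 H2].
  apply is_lim_seq_incr_1.
  apply is_lim_seq_ext with
    (sum_n (fun n => f (Z.of_nat n) + f (- Z.of_nat (S n))%Z)).
  { intros N; apply sum_n_zpart. }
  apply (is_series_plus _ _ _ _ (Series_correct _ H1) (Series_correct _ H2)).
Qed.

Lemma zsum_unique (f : Z -> R) (l : R) : zdec f ->
  is_lim_seq (zpart f) l -> bilateral_series f = l.
Proof.
  intros H Hl. apply zpart_lim in H.
  apply is_lim_seq_unique in H; apply is_lim_seq_unique in Hl.
  rewrite H in Hl; injection Hl; auto.
Qed.

Lemma zsum_ext (f g : Z -> R) : (forall n, f n = g n) ->
  bilateral_series f = bilateral_series g.
Proof.
  intros H; unfold bilateral_series; f_equal; apply Series_ext; intros n; apply H.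
Qed.

Lemma zsum_scal (c : R) (f : Z -> R) :
  bilateral_series (fun n => c * f n) = c * bilateral_series f.
Proof.
  unfold bilateral_series; rewrite !Series_scal_l; ring.
Qed.

Lemma zdec_scal (c : R) (f : Z -> R) : zdec f -> zdec (fun n => c * f n).
Proof.
  intros [M H]; exists (Rabs c * M); intros n.
  rewrite Rabs_mult, Rmult_assoc.
  apply Rmult_le_compat_l; [apply Rabs_pos | apply H].
Qed.

Lemma zbound_plus (M N : R) (f g : Z -> R) :
  zbound M f -> zbound N g -> zbound (M + N) (fun n => f n + g n).
Proof.
  intros Hf Hg n. eapply Rle_trans; [apply Rabs_triang|].
  rewrite Rmult_plus_distr_r; apply Rplus_le_compat; auto.
Qed.

Lemma zdec_plus (f g : Z -> R) : zdec f -> zdec g -> zdec (fun n => f n + g n).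
Proof.
  intros [M Hf] [N Hg]; exists (M + N); apply zbound_plus; assumption.
Qed.

Lemma zsum_plus (f g : Z -> R) : zdec f -> zdec g ->
  bilateral_series (fun n => f n + g n) = bilateral_series f + bilateral_series g.
Proof.
  intros Hf Hg; destruct (zdec_ex f Hf), (zdec_ex g Hg).
  unfold bilateral_series; rewrite !Series_plus by assumption; ring.
Qed.

Lemma zdec_ext (f g : Z -> R) : (forall n, f n = g n) -> zdec f -> zdec g.
Proof. intros H [M Hf]; exists M; intros n; rewrite <- H; apply Hf. Qed.

Lemma zsum_minus (f g : Z -> R) : zdec f -> zdec g ->
  bilateral_series (fun n => f n - g n) = bilateral_series f - bilateral_series g.
Proof.
  intros Hf Hg.
  rewrite (zsum_ext _ (fun n => f n + (- 1) * g n)) by (intros; ring).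
  rewrite zsum_plus, zsum_scal by (try apply zdec_scal; assumption); ring.
Qed.

Lemma zdec_0 : zdec (fun _ => 0).
Proof.
  exists 0; intros n; rewrite Rabs_R0; lra.
Qed.

Lemma zsum_0 : bilateral_series (fun _ => 0) = 0.
Proof.
  rewrite (zsum_ext _ (fun n => 0 * 0)) by (intros; ring).
  rewrite zsum_scal; ring.
Qed.

(** The map n -> -1 - n exchanges the two halves of [bilateral_series] term by term, so no
    convergence is involved. *)
Lemma zsum_reflect (f : Z -> R) :
  bilateral_series (fun n => f (- 1 - n)%Z) = bilateral_series f.
Proof.
  unfold bilateral_series; rewrite Rplus_comm; f_equal;
    apply Series_ext; intros n; f_equal; lia.
Qed.

Lemma zdec_comp (f : Z -> R) (h : Z -> Z) (a : R) : zdec f ->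
  (forall n, Rabs (IZR n) <= Rabs (IZR (h n)) + a) -> zdec (fun n => f (h n)).
Proof.
  intros [M H] Hh; exists (M * exp a); intros n.
  eapply Rle_trans; [apply H|]. rewrite Rmult_assoc, <- exp_plus.
  apply Rmult_le_compat_l; [exact (zbound_nonneg _ _ H)|].
  destruct (Rle_lt_or_eq_dec (- Rabs (IZR (h n))) (a + - Rabs (IZR n))) as [h1|h1].
  - specialize (Hh n); lra.
  - left; apply exp_increasing; exact h1.
  - rewrite h1; lra.
Qed.

Lemma zdec_add (f : Z -> R) (k : Z) : zdec f -> zdec (fun n => f (n + k)%Z).
Proof.
  intros H; apply (zdec_comp f (fun n => n + k)%Z (Rabs (IZR k)) H).
  intros n; rewrite plus_IZR.
  replace (IZR n) with ((IZR n + IZR k) + - IZR k) at 1 by ring.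
  eapply Rle_trans; [apply Rabs_triang|]; rewrite Rabs_Ropp; lra.
Qed.

Lemma zdec_sub (f : Z -> R) (k : Z) : zdec f -> zdec (fun n => f (k - n)%Z).
Proof.
  intros H; apply (zdec_comp f (fun n => k - n)%Z (Rabs (IZR k)) H).
  intros n; rewrite minus_IZR.
  replace (IZR n) with (- (IZR k - IZR n) + IZR k) at 1 by ring.
  eapply Rle_trans; [apply Rabs_triang|]; rewrite Rabs_Ropp; lra.
Qed.

Lemma zdec_mul (f : Z -> R) (m k : Z) : (m <> 0)%Z -> zdec f ->
  zdec (fun n => f (m * n + k)%Z).
Proof.
  intros Hm H; apply (zdec_comp f (fun n => m * n + k)%Z (Rabs (IZR k)) H).
  intros n; rewrite <- !abs_IZR, <- plus_IZR; apply IZR_le; nia.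
Qed.

Lemma geom_lim (K : R) : is_lim_seq (fun N => K * exp (- 1) ^ N) 0.
Proof.
  replace (Finite 0) with (Rbar_mult (Finite K) (Finite 0)) by (simpl; f_equal; ring).
  apply is_lim_seq_scal_l, is_lim_seq_geom.
  destruct exp_opp_1_bound; rewrite Rabs_pos_eq; lra.
Qed.

Lemma geom_small (K eps : R) : 0 < eps ->
  exists N0, forall N, (N0 <= N)%nat -> K * exp (- 1) ^ N < eps.
Proof.
  intros He; assert (L := geom_lim K); apply is_lim_seq_spec in L.
  destruct (L (mkposreal _ He)) as [N0 HN]; exists N0.
  intros N h; specialize (HN N h); rewrite Rminus_0_r in HN.
  eapply Rle_lt_trans; [apply Rle_abs | exact HN].
Qed.

Lemma zdec_lim_nat (f : Z -> R) (h : nat -> Z) : zdec f ->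
  (forall n, (Z.of_nat n <= Z.abs (h n))%Z) -> is_lim_seq (fun n => f (h n)) 0.
Proof.
  intros [M H] Hh.
  apply is_lim_seq_abs_0.
  apply is_lim_seq_le_le with (fun _ => 0) (fun n => M * exp (- 1) ^ n).
  - intros n; split; [apply Rabs_pos|].
    eapply Rle_trans; [apply H|].
    apply Rmult_le_compat_l; [exact (zbound_nonneg _ _ H)|].
    rewrite <- exp_opp_INR, INR_IZR_INZ, <- abs_IZR.
    destruct (Z.eq_dec (Z.of_nat n) (Z.abs (h n))) as [e|e].
    + rewrite e; lra.
    + left; apply exp_increasing, Ropp_lt_contravar, IZR_lt.
      specialize (Hh n); lia.
  - apply is_lim_seq_const.
  - apply geom_lim.
Qed.

(** The window of [zpart f N] is the asymmetric one from -N to N - 1; shifting it by 1 gains the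
    index N and loses -N. *)
Lemma zpart_succ (f : Z -> R) (N : nat) :
  zpart (fun n => f (n + 1)%Z) N
  = zpart f N + f (Z.of_nat N) - f (- Z.of_nat N)%Z.
Proof.
  induction N as [|N IH]; [simpl; ring|].
  cbn [zpart]; rewrite IH.
  replace (- Z.of_nat (S N) + 1)%Z with (- Z.of_nat N)%Z by lia.
  replace (Z.of_nat N + 1)%Z with (Z.of_nat (S N)) by lia. ring.
Qed.

Lemma zsum_succ (f : Z -> R) : zdec f ->
  bilateral_series (fun n => f (n + 1)%Z) = bilateral_series f.
Proof.
  intros H; apply zsum_unique; [apply zdec_add, H|].
  apply is_lim_seq_ext with
    (fun N => zpart f N + f (Z.of_nat N) - f (- Z.of_nat N)%Z).
  { intros N; symmetry; apply zpart_succ. }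
  replace (bilateral_series f) with (bilateral_series f + 0 - 0) by ring.
  apply is_lim_seq_minus'; [apply is_lim_seq_plus'; [apply zpart_lim, H|]|];
    apply zdec_lim_nat; try exact H; intros; lia.
Qed.

Lemma zsum_add (f : Z -> R) (k : Z) : zdec f ->
  bilateral_series (fun n => f (n + k)%Z) = bilateral_series f.
Proof.
  intros H; revert k.
  assert (Hs : forall k, bilateral_series (fun n => f (n + (k + 1))%Z)
                         = bilateral_series (fun n => f (n + k)%Z)).
  { intros k. rewrite <- (zsum_succ (fun n => f (n + k)%Z)) by (apply zdec_add, H).
    apply zsum_ext; intros n; f_equal; lia. }
  apply Z.peano_ind.
  - apply zsum_ext; intros n; f_equal; lia.
  - intros k IH; unfold Z.succ; rewrite Hs; exact IH.
  - intros k IH; rewrite <- Hs.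
    replace (Z.pred k + 1)%Z with k by lia; exact IH.
Qed.

Lemma zsum_sub (f : Z -> R) (k : Z) : zdec f ->
  bilateral_series (fun n => f (k - n)%Z) = bilateral_series f.
Proof.
  intros H; rewrite <- (zsum_add f (k + 1) H).
  rewrite <- (zsum_reflect (fun n => f (n + (k + 1))%Z)).
  apply zsum_ext; intros n; f_equal; lia.
Qed.

Lemma zdec_sum_n (F : nat -> Z -> R) (p : nat) : (forall j, zdec (F j)) ->
  zdec (fun n => sum_n (fun j => F j n) p).
Proof.
  intros H; induction p as [|p IH].
  - apply (zdec_ext (F O)); [intros n; rewrite sum_O; reflexivity | apply H].
  - apply (zdec_ext (fun n => sum_n (fun j => F j n) p + F (S p) n)).
    + intros n; rewrite sum_Sn; reflexivity.
    + apply zdec_plus; [exact IH | apply H].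
Qed.

Lemma zsum_sum_n (F : nat -> Z -> R) (p : nat) : (forall j, zdec (F j)) ->
  bilateral_series (fun n => sum_n (fun j => F j n) p)
  = sum_n (fun j => bilateral_series (F j)) p.
Proof.
  intros H; induction p as [|p IH].
  - rewrite sum_O; apply zsum_ext; intros n; apply sum_O.
  - rewrite sum_Sn, <- IH.
    change plus with Rplus; rewrite <- zsum_plus by (try apply zdec_sum_n; apply H).
    apply zsum_ext; intros n; exact (sum_Sn (fun j => F j n) p).
Qed.

Lemma zpart_add (f : Z -> R) (N p : nat) :
  zpart f (N + S p)
  = zpart f N + sum_n (fun j => f (Z.of_nat N + Z.of_nat j)%Z) p
    + sum_n (fun j => f (- Z.of_nat (N + S p) + Z.of_nat j)%Z) p.
Proof.
  induction p as [|p IH].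
  - rewrite !sum_O, Nat.add_1_r; cbn [zpart].
    replace (Z.of_nat N + Z.of_nat 0)%Z with (Z.of_nat N) by lia.
    replace (- Z.of_nat (S N) + Z.of_nat 0)%Z with (- Z.of_nat (S N))%Z by lia.
    ring.
  - rewrite Nat.add_succ_r; cbn [zpart]; rewrite IH.
    rewrite (sum_Sn (fun j => f (Z.of_nat N + Z.of_nat j)%Z)).
    unfold sum_n at 4; rewrite sum_Sn_m by lia; rewrite <- sum_n_m_S.
    change (sum_n_m ?a 0 p) with (sum_n a p).
    rewrite (sum_n_ext (fun j => f (- Z.of_nat (S (N + S p)) + Z.of_nat (S j))%Z)
               (fun j => f (- Z.of_nat (N + S p) + Z.of_nat j)%Z))
      by (intros j; f_equal; lia).
    replace (Z.of_nat N + Z.of_nat (S p))%Z with (Z.of_nat (N + S p)) by lia.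
    replace (- Z.of_nat (S (N + S p)) + Z.of_nat 0)%Z
      with (- Z.of_nat (S (N + S p)))%Z by lia.
    change plus with Rplus; ring.
Qed.

(** The window from -N to N - 1, multiplied by the modulus, is tiled exactly by blocks of length
    [S p]. The grouped partial sums are therefore a subsequence of those of [f]. The modulus is
    written [S p] to keep it nonzero. *)
Lemma zsum_split (f : Z -> R) (p : nat) : zdec f ->
  bilateral_series f
  = sum_n (fun j => bilateral_series
             (fun n => f (Z.of_nat (S p) * n + Z.of_nat j)%Z)) p.
Proof.
  intros H.
  assert (Hj : forall j, zdec (fun n => f (Z.of_nat (S p) * n + Z.of_nat j)%Z))
    by (intros j; apply zdec_mul; [lia | exact H]).
  rewrite <- zsum_sum_n by exact Hj.
  assert (E : forall N,
    zpart (fun n => sum_n (fun j => f (Z.of_nat (S p) * n + Z.of_nat j)%Z) p) N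
    = zpart f (N * S p)).
  { induction N as [|N IH]; [reflexivity|].
    replace (S N * S p)%nat with (N * S p + S p)%nat by lia.
    rewrite zpart_add; cbn [zpart]; rewrite IH, Rplus_assoc.
    f_equal; f_equal; apply sum_n_ext; intros j; f_equal; nia. }
  symmetry; apply zsum_unique; [apply zdec_sum_n, Hj|].
  apply is_lim_seq_ext with (fun N => zpart f (N * S p)).
  { intros N; symmetry; apply E. }
  apply (is_lim_seq_subseq (zpart f) _ (fun N => N * S p)%nat).
  - apply eventually_subseq; intros; lia.
  - apply zpart_lim, H.
Qed.

Lemma zsum_split2 (f : Z -> R) : zdec f ->
  bilateral_series f = bilateral_series (fun n => f (2 * n)%Z)
                       + bilateral_series (fun n => f (2 * n + 1)%Z).
Proof.
  intros H; rewrite (zsum_split f 1 H), sum_Sn, sum_O.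
  change plus with Rplus; f_equal; apply zsum_ext; intros n; f_equal; lia.
Qed.

(** A telescoping majorant: with r = exp (-1) <= 1/2, each new pair of terms is at most 2 M r^n <= 4
    M (r^n - r^(n+1)). *)
Lemma zpart_diff (M : R) (f : Z -> R) (N k : nat) : zbound M f ->
  Rabs (zpart f (N + k) - zpart f N)
  <= 4 * M * (exp (- 1) ^ N - exp (- 1) ^ (N + k)).
Proof.
  intros H; induction k as [|k IH].
  - rewrite Nat.add_0_r, !Rminus_diag, Rabs_R0; lra.
  - rewrite Nat.add_succ_r; cbn [zpart].
    destruct (zbound_term M f (N + k) H) as [h1 h2].
    replace (zpart f (N + k) + (f (Z.of_nat (N + k)) + f (- Z.of_nat (S (N + k)))%Z)
             - zpart f N)
      with ((zpart f (N + k) - zpart f N)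
            + (f (Z.of_nat (N + k)) + f (- Z.of_nat (S (N + k)))%Z)) by ring.
    eapply Rle_trans; [apply Rabs_triang|].
    assert (h3 := Rabs_triang (f (Z.of_nat (N + k))) (f (- Z.of_nat (S (N + k)))%Z)).
    simpl pow.
    assert (h4 := exp_opp_1_bound).
    assert (h5 : 0 <= M * exp (- 1) ^ (N + k)).
    { apply Rmult_le_pos; [exact (zbound_nonneg _ _ H) | apply pow_le; lra]. }
    nra.
Qed.

Lemma zpart_tail (M : R) (f : Z -> R) (N : nat) : zbound M f ->
  Rabs (bilateral_series f - zpart f N) <= 4 * M * exp (- 1) ^ N.
Proof.
  intros H.
  assert (L : is_lim_seq (fun k => Rabs (zpart f (k + N) - zpart f N))
                (Rabs (bilateral_series f - zpart f N))).
  { apply (is_lim_seq_abs _ (Finite _)), is_lim_seq_minus'; [|apply is_lim_seq_const].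
    apply is_lim_seq_incr_n, zpart_lim; exists M; exact H. }
  refine (is_lim_seq_le _ (fun _ => 4 * M * exp (- 1) ^ N) _ _ _ L
            (is_lim_seq_const _)).
  intros k; rewrite Nat.add_comm.
  eapply Rle_trans; [apply zpart_diff, H|].
  apply Rmult_le_compat_l; [assert (h := zbound_nonneg _ _ H); lra|].
  assert (h := pow_le (exp (-1)) (N + k)); destruct exp_opp_1_bound; lra.
Qed.

Lemma zsum_bound (M : R) (f : Z -> R) : zbound M f ->
  Rabs (bilateral_series f) <= 4 * M.
Proof.
  intros H; assert (h := zpart_tail M f 0 H); simpl in h.
  rewrite Rminus_0_r in h; lra.
Qed.

(** * Double sums and interchange of summation *)

Definition zdec2 (g : Z -> Z -> R) : Prop :=
  exists M : R, forall m n : Z,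
    Rabs (g m n) <= M * exp (- Rabs (IZR m)) * exp (- Rabs (IZR n)).

Lemma zdec2_bounds (g : Z -> Z -> R) : zdec2 g ->
  exists M, 0 <= M /\
    (forall m, zbound (M * exp (- Rabs (IZR m))) (fun n => g m n)) /\
    (forall n, zbound (M * exp (- Rabs (IZR n))) (fun m => g m n)).
Proof.
  intros [M H]; exists M; split; [|split].
  - specialize (H 0%Z 0%Z); rewrite Rabs_R0, Ropp_0, exp_0 in H.
    assert (H0 := Rabs_pos (g 0%Z 0%Z)); lra.
  - intros m n; apply H.
  - intros n m; specialize (H m n); lra.
Qed.

Lemma zdec_zsum (g : Z -> Z -> R) : zdec2 g ->
  zdec (fun m => bilateral_series (fun n => g m n)).
Proof.
  intros H; destruct (zdec2_bounds g H) as (M & HM & H1 & H2).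
  exists (4 * M); intros m.
  rewrite Rmult_assoc; apply zsum_bound, H1.
Qed.

Lemma zdec_zpart (g : Z -> Z -> R) (N : nat) : (forall m, zdec (g m)) ->
  zdec (fun n => zpart (fun m => g m n) N).
Proof.
  intros H; induction N as [|N IH]; [apply zdec_0|].
  cbn [zpart]; apply zdec_plus; [exact IH | apply zdec_plus; apply H].
Qed.

Lemma zsum_zpart (g : Z -> Z -> R) (N : nat) : (forall m, zdec (g m)) ->
  zpart (fun m => bilateral_series (g m)) N
  = bilateral_series (fun n => zpart (fun m => g m n) N).
Proof.
  intros H; induction N as [|N IH]; [symmetry; apply zsum_0|].
  cbn [zpart]; rewrite IH, !zsum_plus; try reflexivity; try apply H.
  - apply zdec_zpart, H.
  - apply zdec_plus; apply H.
Qed.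

Lemma zdec2_swap (g : Z -> Z -> R) : zdec2 g -> zdec2 (fun m n => g n m).
Proof. intros [M H]; exists M; intros m n; specialize (H n m); lra. Qed.

(** A finite partial sum over m commutes with the sum over n. The remaining tails are at most 4 M
    exp (-|n|) r^N with r = exp (-1), and summing them over n costs another factor 4, whence the
    16. *)
Lemma zsum_swap (g : Z -> Z -> R) : zdec2 g ->
  bilateral_series (fun m => bilateral_series (fun n => g m n))
  = bilateral_series (fun n => bilateral_series (fun m => g m n)).
Proof.
  intros H; destruct (zdec2_bounds g H) as (M & HM & H1 & H2).
  assert (Hm : forall m, zdec (g m)) by (intros m; eexists; apply H1).
  assert (Hc : zdec (fun n => bilateral_series (fun m => g m n)))
    by (apply (zdec_zsum (fun n m => g m n)), zdec2_swap, H).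
  apply zsum_unique; [apply zdec_zsum, H|].
  set (R0 := bilateral_series _).
  assert (B : forall N, Rabs (zpart (fun m => bilateral_series (g m)) N - R0)
                        <= 16 * M * exp (- 1) ^ N).
  { intros N; rewrite zsum_zpart by exact Hm; unfold R0.
    rewrite <- zsum_minus by (try apply zdec_zpart; assumption).
    replace (16 * M * exp (- 1) ^ N) with (4 * (4 * M * exp (- 1) ^ N)) by ring.
    apply zsum_bound; intros n.
    rewrite Rabs_minus_sym.
    eapply Rle_trans; [apply zpart_tail, H2|]; right; ring. }
  apply is_lim_seq_spec; intros eps.
  destruct (geom_small (16 * M) _ (cond_pos eps)) as [N0 HN]; exists N0; intros N h.
  eapply Rle_lt_trans; [apply B | exact (HN N h)].
Qed.

Lemma zsum_single (c : R) (k : Z) :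
  bilateral_series (fun n => if Z.eq_dec n k then c else 0) = c.
Proof.
  assert (H0 : zdec (fun n => if Z.eq_dec n 0 then c else 0)).
  { exists (Rabs c); intros n; destruct (Z.eq_dec n 0) as [->|e].
    - rewrite Rabs_R0, Ropp_0, exp_0; lra.
    - rewrite Rabs_R0; apply Rmult_le_pos; [apply Rabs_pos | left; apply exp_pos]. }
  transitivity (bilateral_series (fun n => if Z.eq_dec n 0 then c else 0)).
  - rewrite <- (zsum_add _ (- k) H0); apply zsum_ext; intros n.
    destruct (Z.eq_dec n k), (Z.eq_dec (n + - k) 0); try reflexivity; lia.
  - apply zsum_unique; [exact H0|].
    apply is_lim_seq_incr_1, is_lim_seq_ext with (fun _ => c);
      [|apply is_lim_seq_const].
    induction n as [|n IH]; [simpl; ring|].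
    remember (S n) as m; cbn [zpart]; rewrite <- IH.
    destruct (Z.eq_dec (Z.of_nat m) 0); [lia|].
    destruct (Z.eq_dec (- Z.of_nat (S m)) 0); [lia|]. ring.
Qed.

(** * Poisson summation *)

Lemma cos_Rabs (x : R) : cos (Rabs x) = cos x.
Proof. unfold Rabs; destruct (Rcase_abs x); [apply cos_neg | reflexivity]. Qed.

Lemma cos_2PI_le (x y : R) : Rabs x <= Rabs y <= 1 / 2 ->
  cos (2 * PI * y) <= cos (2 * PI * x).
Proof.
  intros [H1 H2]; assert (HP := PI_RGT_0).
  assert (e : forall t, cos (2 * PI * t) = cos (2 * PI * Rabs t)).
  { intros t; rewrite <- cos_Rabs, !Rabs_mult, (Rabs_pos_eq 2), (Rabs_pos_eq PI)
      by lra; reflexivity. }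
  rewrite (e x), (e y); assert (h := Rabs_pos x).
  apply cos_decr_1; nra.
Qed.

Lemma ex_RInt_cont (f : R -> R) (a b : R) :
  (forall x, Rmin a b <= x <= Rmax a b -> continuous f x) -> ex_RInt f a b.
Proof. apply (@ex_RInt_continuous R_CompleteNormedModule). Qed.

Lemma continuous_pow (f : R -> R) (m : nat) (x : R) :
  continuous f x -> continuous (fun t => f t ^ m) x.
Proof.
  intros H; induction m as [|m IH]; [apply continuous_const|].
  apply (continuous_mult f (fun t => f t ^ m)); assumption.
Qed.

Lemma continuous_cos_lin (a b x : R) : continuous (fun t => cos (a * t + b)) x.
Proof.
  apply (continuous_comp (fun t => a * t + b) cos).
  - apply (continuous_plus (fun t => a * t) (fun _ => b));
      [|apply continuous_const].
    apply (continuous_mult (fun _ => a) (fun t => t));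
      [apply continuous_const | apply continuous_id].
  - apply continuous_cos.
Qed.

Lemma continuous_cos_scal (a x : R) : continuous (fun t => cos (a * t)) x.
Proof.
  apply continuous_ext with (fun t => cos (a * t + 0)).
  - intros t; f_equal; ring.
  - apply continuous_cos_lin.
Qed.

(* ring and field reject equations stated in the carrier of a normed module. *)
Ltac to_R_eq := match goal with |- @eq _ ?a ?b => change (@eq R a b) end.

(** * A continuous function orthogonal to all cosines vanishes at 0 *)

Section Uniqueness.

Variables (f : R -> R) (B : R).
Hypothesis f_cont : forall x, Rabs x <= 1 / 2 -> continuous f x.
Hypothesis f_bound : forall x, Rabs x <= 1 / 2 -> Rabs (f x) <= B.
Hypothesis f_orth : forall k : nat,
  RInt (fun x => f x * cos (2 * PI * INR k * x)) (- (1 / 2)) (1 / 2) = 0.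

(** A trigonometric polynomial that is at least 1 for |x| <= d, exceeds 1 inside, and is at most 1
    in absolute value on the rest of the period. Its powers concentrate near 0. *)
Let kernel (d x : R) : R := 1 + cos (2 * PI * x) - cos (2 * PI * d).

Lemma kernel_cont (d : R) (m : nat) (x : R) :
  continuous (fun t => kernel d t ^ m) x.
Proof.
  apply continuous_pow.
  apply (continuous_minus (fun t => 1 + cos (2 * PI * t)) (fun _ => cos (2 * PI * d)));
    [|apply continuous_const].
  apply (continuous_plus (fun _ => 1) (fun t => cos (2 * PI * t)));
    [apply continuous_const | apply continuous_cos_scal].
Qed.

Lemma f_kernel_ex (d : R) (m : nat) (a b : R) (g : R -> R) :
  - (1 / 2) <= a <= 1 / 2 -> - (1 / 2) <= b <= 1 / 2 ->
  (forall x, continuous g x) ->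
  ex_RInt (fun x => f x * kernel d x ^ m * g x) a b.
Proof.
  intros Ha Hb Hg; apply ex_RInt_cont; intros x Hx.
  apply (continuous_mult (fun x => f x * kernel d x ^ m) g); [|apply Hg].
  apply (continuous_mult f (fun x => kernel d x ^ m)); [|apply kernel_cont].
  apply f_cont, Rabs_le; revert Hx; apply Rmax_case; apply Rmin_case; lra.
Qed.

(** Multiplication by cos (2 pi x) sends the frequency k to k - 1 and k + 1, so the induction on [m]
    must carry all frequencies. Integer ones spare a special case at 0. *)
Lemma f_kernel_orth (d : R) (m : nat) (k : Z) :
  RInt (fun x => f x * kernel d x ^ m * cos (2 * PI * IZR k * x))
    (- (1 / 2)) (1 / 2) = 0.
Proof.
  revert k; induction m as [|m IH]; intros k.
  - rewrite <- (f_orth (Z.abs_nat k)); apply RInt_ext; intros x _.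
    rewrite pow_O, Rmult_1_r; f_equal.
    rewrite INR_IZR_INZ, Zabs2Nat.id_abs, abs_IZR.
    unfold Rabs; destruct (Rcase_abs (IZR k)); [|reflexivity].
    rewrite <- cos_neg; f_equal; ring.
  - set (F := fun j x => f x * kernel d x ^ m * cos (2 * PI * IZR j * x)).
    assert (Hex : forall j, ex_RInt (F j) (- (1 / 2)) (1 / 2)).
    { intros j; apply f_kernel_ex; try lra; intros x; apply continuous_cos_scal. }
    rewrite (RInt_ext _ (fun x => (1 - cos (2 * PI * d)) * F k x
              + (1 / 2 * F (k + 1)%Z x + 1 / 2 * F (k - 1)%Z x))).
    + assert (Hs : forall c j, ex_RInt (fun x => c * F j x) (- (1 / 2)) (1 / 2)).
      { intros c j; apply (@ex_RInt_scal R_NormedModule (F j) _ _ c), Hex. }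
      rewrite (@RInt_plus R_CompleteNormedModule
                (fun x => (1 - cos (2 * PI * d)) * F k x)
                (fun x => 1 / 2 * F (k + 1)%Z x + 1 / 2 * F (k - 1)%Z x)).
      * rewrite (@RInt_plus R_CompleteNormedModule
                  (fun x => 1 / 2 * F (k + 1)%Z x) (fun x => 1 / 2 * F (k - 1)%Z x))
          by apply Hs.
        rewrite !(fun c j => @RInt_scal R_CompleteNormedModule (F j) _ _ c (Hex j)).
        unfold F; rewrite !IH; unfold plus, scal; simpl; unfold mult; simpl.
        to_R_eq; ring.
      * apply Hs.
      * apply (@ex_RInt_plus R_NormedModule); apply Hs.
    + intros x _; unfold F. rewrite plus_IZR, minus_IZR.
      replace (2 * PI * (IZR k + 1) * x) with (2 * PI * IZR k * x + 2 * PI * x) by ring.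
      replace (2 * PI * (IZR k - 1) * x) with (2 * PI * IZR k * x - 2 * PI * x) by ring.
      rewrite cos_plus, cos_minus; simpl pow; unfold kernel; to_R_eq; field.
Qed.

(** If f 0 > 0, then f >= f 0 / 2 near 0, and the integral of f kernel^m over |x| <= d/2 grows at
    least like q^m with q > 1. The rest of the period contributes at least -B, yet the total is 0
    for every m. *)
Lemma not_pos_at_0 : ~ 0 < f 0.
Proof.
  intros H0.
  assert (Hc := f_cont 0 ltac:(rewrite Rabs_R0; lra)).
  assert (He : 0 < f 0 / 2) by lra.
  destruct (proj1 (filterlim_locally _ _) Hc (mkposreal _ He)) as [d0 Hd0].
  set (d := Rmin (d0 / 2) (1 / 8)).
  assert (Hd : 0 < d <= 1 / 8 /\ d < d0).
  { unfold d; assert (h := cond_pos d0); apply Rmin_case_strong; intros; lra. }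
  assert (Hfd : forall x, Rabs x <= d -> f 0 / 2 <= f x).
  { intros x Hx; assert (Hb : ball 0 d0 x).
    { unfold ball; simpl; unfold AbsRing_ball, abs, minus, plus, opp; simpl.
      rewrite Ropp_0, Rplus_0_r; lra. }
    specialize (Hd0 x Hb); unfold ball in Hd0; simpl in Hd0.
    unfold AbsRing_ball, abs, minus, plus, opp in Hd0; simpl in Hd0.
    apply Rabs_def2 in Hd0; lra. }
  assert (HB : 0 <= B).
  { eapply Rle_trans; [apply (Rabs_pos (f 0))|].
    apply f_bound; rewrite Rabs_R0; lra. }
  assert (HP := PI_RGT_0).
  assert (K1 : forall x, Rabs x <= d -> 1 <= kernel d x).
  { intros x Hx; unfold kernel.
    assert (h := cos_2PI_le x d); rewrite (Rabs_pos_eq d) in h by lra.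
    specialize (h ltac:(lra)); lra. }
  assert (K2 : forall x, d <= Rabs x <= 1 / 2 -> Rabs (kernel d x) <= 1).
  { intros x Hx; unfold kernel; apply Rabs_le.
    assert (h := cos_2PI_le d x); rewrite (Rabs_pos_eq d) in h by lra.
    specialize (h ltac:(lra)).
    assert (h1 := COS_bound (2 * PI * x)); assert (h2 := COS_bound (2 * PI * d)); lra. }
  set (q := kernel d (d / 2)).
  assert (Hq : 1 < q).
  { unfold q, kernel.
    assert (h : cos (2 * PI * d) < cos (2 * PI * (d / 2))); [|lra].
    apply cos_decreasing_1; nra. }
  assert (K3 : forall x, Rabs x <= d / 2 -> q <= kernel d x).
  { intros x Hx; unfold q, kernel.
    assert (h := cos_2PI_le x (d / 2)); rewrite (Rabs_pos_eq (d / 2)) in h by lra.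
    specialize (h ltac:(lra)); lra. }
  assert (Hm : forall m, d * (f 0 / 2 * q ^ m) <= B).
  { intros m.
    set (F := fun x => f x * kernel d x ^ m * 1).
    assert (Hex : forall a b, - (1 / 2) <= a <= 1 / 2 -> - (1 / 2) <= b <= 1 / 2 ->
                    ex_RInt F a b).
    { intros a b Ha Hb; apply f_kernel_ex; try assumption.
      intros x; apply continuous_const. }
    (* Where the kernel may be large, [f] is positive; elsewhere the kernel is at most 1 in absolute
       value. This bounds the two outer pieces below, uniformly in m. *)
    assert (Hlow : forall x, Rabs x <= 1 / 2 -> - B <= F x).
    { intros x Hx; unfold F; rewrite Rmult_1_r.
      destruct (Rle_dec (Rabs x) d) as [h|h].
      - assert (h1 := Hfd x h); assert (h2 := pow_R1_Rle _ m (K1 x h)); nra.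
      - assert (h1 : Rabs (f x * kernel d x ^ m) <= B * 1).
        { rewrite Rabs_mult; apply Rmult_le_compat; try apply Rabs_pos.
          - apply f_bound, Hx.
          - rewrite <- RPow_abs, <- (pow1 m); apply pow_incr; split;
              [apply Rabs_pos | apply K2; lra]. }
        rewrite Rmult_1_r in h1; apply Rabs_le_between in h1; lra. }
    assert (Htot : RInt F (- (1 / 2)) (1 / 2) = 0).
    { rewrite <- (f_kernel_orth d m 0); apply RInt_ext; intros x _; unfold F.
      rewrite Rmult_0_r, Rmult_0_l, cos_0; reflexivity. }
    rewrite <- (@RInt_Chasles R_CompleteNormedModule F _ (- (d / 2)) (1 / 2)) in Htot
      by (apply Hex; lra).
    rewrite <- (@RInt_Chasles R_CompleteNormedModule F (- (d / 2)) (d / 2) (1 / 2)) in Htot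
      by (apply Hex; lra).
    assert (Hgen : forall a b c, - (1 / 2) <= a <= b -> b <= 1 / 2 ->
      (forall x, a <= x <= b -> c <= F x) -> (b - a) * c <= RInt F a b).
    { intros a b c Ha Hb Hc'.
      assert (e : RInt (fun _ => c) a b = (b - a) * c)
        by (rewrite RInt_const; reflexivity).
      rewrite <- e.
      apply RInt_le; [lra | apply ex_RInt_const | apply Hex; lra|].
      intros x Hx; apply Hc'; lra. }
    assert (h1 := Hgen (- (1 / 2)) (- (d / 2)) (- B) ltac:(lra) ltac:(lra)
                   ltac:(intros x Hx; apply Hlow, Rabs_le; lra)).
    assert (h3 := Hgen (d / 2) (1 / 2) (- B) ltac:(lra) ltac:(lra)
                   ltac:(intros x Hx; apply Hlow, Rabs_le; lra)).
    assert (h2 : (d / 2 - - (d / 2)) * (f 0 / 2 * q ^ m) <= RInt F (- (d / 2)) (d / 2)).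
    { apply Hgen; [lra | lra|].
      intros x Hx; unfold F; rewrite Rmult_1_r.
      assert (Hx' : Rabs x <= d / 2) by (apply Rabs_le; lra).
      apply Rmult_le_compat; [lra | apply pow_le; lra | apply Hfd; lra|].
      apply pow_incr; split; [lra | apply K3, Hx']. }
    change plus with Rplus in Htot; simpl in Htot.
    nra. }
  assert (Hpos : 0 < d * (f 0 / 2)) by (apply Rmult_lt_0_compat; lra).
  destruct (Pow_x_infinity q ltac:(rewrite Rabs_pos_eq; lra) (B / (d * (f 0 / 2)) + 1))
    as [N HN].
  specialize (HN N (le_n N)); specialize (Hm N).
  rewrite Rabs_pos_eq in HN by (apply pow_le; lra).
  assert (h : B / (d * (f 0 / 2)) * (d * (f 0 / 2)) = B) by (field; lra).
  nra.
Qed.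

End Uniqueness.

(** Cosines see only the even part of [f], so 0 is the point at which the conclusion concerns [f]
    itself. Positivity is excluded for both [f] and its opposite. *)
Lemma cos_orthogonal_0 (f : R -> R) (B : R) :
  (forall x, Rabs x <= 1 / 2 -> continuous f x) ->
  (forall x, Rabs x <= 1 / 2 -> Rabs (f x) <= B) ->
  (forall k : nat,
     RInt (fun x => f x * cos (2 * PI * INR k * x)) (- (1 / 2)) (1 / 2) = 0) ->
  f 0 = 0.
Proof.
  intros Hc HB Ho.
  assert (h1 := not_pos_at_0 f B Hc HB Ho).
  assert (h2 : ~ 0 < - f 0).
  { apply (not_pos_at_0 (fun x => - f x) B).
    - intros x Hx; apply (@continuous_opp _ R_AbsRing R_NormedModule), Hc, Hx.
    - intros x Hx; rewrite Rabs_Ropp; apply HB, Hx.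
    - intros k.
      rewrite (RInt_ext _ (fun x => - (f x * cos (2 * PI * INR k * x))))
        by (intros; to_R_eq; ring).
      rewrite (@RInt_opp R_CompleteNormedModule (fun x => f x * cos (2 * PI * INR k * x))).
      + rewrite Ho; apply Ropp_0.
      + apply ex_RInt_cont; intros x Hx.
        apply (continuous_mult f (fun x => cos (2 * PI * INR k * x)));
          [|apply continuous_cos_scal].
        apply Hc, Rabs_le; revert Hx; apply Rmax_case; apply Rmin_case; lra. }
  lra.
Qed.

(** * Termwise continuity and integration of uniformly convergent series *)

Section UniformSeries.

Variables (phi : Z -> R -> R) (M : R).
Hypothesis phi_cont : forall n x, continuous (phi n) x.
Hypothesis phi_bound : forall x, Rabs x <= 1 -> zbound M (fun n => phi n x).

Lemma zpart_cont (N : nat) (x : R) : continuous (fun t => zpart (fun n => phi n t) N) x.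
Proof.
  induction N as [|N IH]; [apply continuous_const|].
  apply (continuous_plus (fun t => zpart (fun n => phi n t) N)
    (fun t => phi (Z.of_nat N) t + phi (- Z.of_nat (S N))%Z t)); [exact IH|].
  apply (continuous_plus (phi (Z.of_nat N)) (phi (- Z.of_nat (S N))%Z)); apply phi_cont.
Qed.

(** The uniform bound is assumed on |x| <= 1 so that the endpoints of the period, at 1/2 and -1/2,
    are interior points here. *)
Lemma zsum_cont (x : R) : Rabs x < 1 ->
  continuous (fun t => bilateral_series (fun n => phi n t)) x.
Proof.
  intros Hx; apply filterlim_locally; intros eps.
  assert (He : 0 < eps / 3) by (assert (h := cond_pos eps); lra).
  destruct (geom_small (4 * M) _ He) as [N HN]; specialize (HN N (le_n N)).
  assert (H1 := proj1 (filterlim_locally _ _) (zpart_cont N x) (mkposreal _ He)).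
  assert (Hd : 0 < 1 - Rabs x) by lra.
  assert (H2 : locally x (fun t => Rabs t <= 1)).
  { exists (mkposreal _ Hd); intros t Ht.
    unfold ball in Ht; simpl in Ht; unfold AbsRing_ball, abs, minus, plus, opp in Ht.
    simpl in Ht.
    replace t with ((t + - x) + x) by ring.
    eapply Rle_trans; [apply Rabs_triang|]; lra. }
  generalize (filter_and _ _ H1 H2); apply filter_imp; intros t [h1 h2].
  unfold ball in h1 |- *; simpl in h1 |- *.
  unfold AbsRing_ball, abs, minus, plus, opp in h1 |- *; simpl in h1 |- *.
  assert (t1 := zpart_tail M _ N (phi_bound t h2)).
  assert (t2 := zpart_tail M _ N (phi_bound x (Rlt_le _ _ Hx))).
  apply Rabs_def1; apply Rabs_def2 in h1; apply Rabs_le_between in t1;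
    apply Rabs_le_between in t2; lra.
Qed.

Lemma RInt_zpart (N : nat) :
  RInt (fun t => zpart (fun n => phi n t) N) (- (1 / 2)) (1 / 2)
  = zpart (fun n => RInt (phi n) (- (1 / 2)) (1 / 2)) N.
Proof.
  assert (Hex : forall n, ex_RInt (phi n) (- (1 / 2)) (1 / 2))
    by (intros n; apply ex_RInt_cont; intros; apply phi_cont).
  induction N as [|N IH].
  - simpl; rewrite (@RInt_const R_CompleteNormedModule); apply Rmult_0_r.
  - cbn [zpart]; rewrite <- IH.
    rewrite (@RInt_plus R_CompleteNormedModule (fun t => zpart (fun n => phi n t) N)
      (fun t => phi (Z.of_nat N) t + phi (- Z.of_nat (S N))%Z t)).
    + rewrite (@RInt_plus R_CompleteNormedModule (phi (Z.of_nat N)) (phi (- Z.of_nat (S N))%Z));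
        [reflexivity | apply Hex | apply Hex].
    + apply ex_RInt_cont; intros; apply zpart_cont.
    + apply (@ex_RInt_plus R_NormedModule); apply Hex.
Qed.

Lemma zdec_RInt : zdec (fun n => RInt (phi n) (- (1 / 2)) (1 / 2)).
Proof.
  exists M; intros n.
  replace (M * exp (- Rabs (IZR n)))
    with ((1 / 2 - - (1 / 2)) * (M * exp (- Rabs (IZR n)))) by lra.
  apply abs_RInt_le_const; [lra | apply ex_RInt_cont; intros; apply phi_cont|].
  intros t Ht; apply phi_bound, Rabs_le; lra.
Qed.

Lemma RInt_zsum :
  RInt (fun t => bilateral_series (fun n => phi n t)) (- (1 / 2)) (1 / 2)
  = bilateral_series (fun n => RInt (phi n) (- (1 / 2)) (1 / 2)).
Proof.
  symmetry; apply zsum_unique; [apply zdec_RInt|].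
  apply is_lim_seq_spec; intros eps.
  destruct (geom_small (4 * M) _ (cond_pos eps)) as [N0 HN]; exists N0; intros N h.
  specialize (HN N h); eapply Rle_lt_trans; [|exact HN].
  rewrite <- RInt_zpart.
  assert (Hex : ex_RInt (fun t => bilateral_series (fun n => phi n t)) (- (1 / 2)) (1 / 2)).
  { apply ex_RInt_cont; intros x Hx; apply zsum_cont.
    rewrite Rmin_left, Rmax_right in Hx by lra; apply Rabs_def1; lra. }
  assert (Hex' : ex_RInt (fun t => zpart (fun n => phi n t) N) (- (1 / 2)) (1 / 2)).
  { apply ex_RInt_cont; intros; apply zpart_cont. }
  rewrite <- (@RInt_minus R_CompleteNormedModule) by assumption.
  replace (4 * M * exp (- 1) ^ N)
    with ((1 / 2 - - (1 / 2)) * (4 * M * exp (- 1) ^ N)) by lra.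
  apply abs_RInt_le_const; [lra | apply (@ex_RInt_minus R_NormedModule); assumption|].
  intros t Ht; change minus with Rminus; rewrite Rabs_minus_sym.
  apply zpart_tail, phi_bound, Rabs_le; lra.
Qed.

End UniformSeries.

(** * Integrals over the real line *)

Definition rdec (f : R -> R) : Prop :=
  exists M, forall x, Rabs (f x) <= M * exp (- Rabs x).

(* The integral over the real line, cut at the half-integers. *)
Definition line_int (f : R -> R) : R :=
  bilateral_series (fun n => RInt (fun x => f (x + IZR n)) (- (1 / 2)) (1 / 2)).

Lemma exp_le (x y : R) : x <= y -> exp x <= exp y.
Proof.
  intros [h|h]; [left; apply exp_increasing, h | rewrite h; apply Rle_refl].
Qed.

Lemma rdec_translates (f : R -> R) (M : R) :
  (forall x, Rabs (f x) <= M * exp (- Rabs x)) ->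
  forall x, Rabs x <= 1 -> zbound (M * exp 1) (fun n => f (x + IZR n)).
Proof.
  intros H x Hx n.
  assert (HM : 0 <= M).
  { specialize (H 0); rewrite Rabs_R0, Ropp_0, exp_0 in H.
    assert (h := Rabs_pos (f 0)); lra. }
  eapply Rle_trans; [apply H|].
  rewrite Rmult_assoc, <- exp_plus; apply Rmult_le_compat_l; [exact HM|].
  apply exp_le.
  assert (h := Rabs_triang (x + IZR n) (- x)); rewrite Rabs_Ropp in h.
  replace (x + IZR n + - x) with (IZR n) in h by ring; lra.
Qed.

Lemma continuous_translate (f : R -> R) (a x : R) : (forall x, continuous f x) ->
  continuous (fun t => f (t + a)) x.
Proof.
  intros H; apply (continuous_comp (fun t => t + a) f); [|apply H].
  apply (continuous_plus (fun t => t) (fun _ => a));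
    [apply continuous_id | apply continuous_const].
Qed.

Lemma RInt_translate (f : R -> R) (a b v : R) : (forall x, continuous f x) ->
  RInt (fun x => f (x + v)) a b = RInt f (a + v) (b + v).
Proof.
  intros H.
  assert (h := @RInt_comp_lin R_CompleteNormedModule f 1 v a b).
  rewrite !Rmult_1_l in h; rewrite <- h.
  - apply RInt_ext; intros x _; unfold scal; simpl; unfold mult; simpl.
    rewrite !Rmult_1_l; reflexivity.
  - apply ex_RInt_cont; intros; apply H.
Qed.

Lemma line_int_ext (f g : R -> R) : (forall x, f x = g x) -> line_int f = line_int g.
Proof.
  intros H; apply zsum_ext; intros n; apply RInt_ext; intros x _; apply H.
Qed.

(** The unit intervals centred at -N, ..., N - 1 fit together; the asymmetry of the endpoints is
    that of [zpart]. *)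
Lemma zpart_RInt (f : R -> R) (N : nat) : (forall x, continuous f x) ->
  zpart (fun n => RInt (fun x => f (x + IZR n)) (- (1 / 2)) (1 / 2)) N
  = RInt f (- INR N - 1 / 2) (INR N - 1 / 2).
Proof.
  intros H.
  assert (Hex : forall a b, ex_RInt f a b) by (intros; apply ex_RInt_cont; auto).
  induction N as [|N IH].
  - simpl zpart; simpl INR; replace (- 0 - 1 / 2) with (0 - 1 / 2) by ring.
    symmetry; exact (@RInt_point R_CompleteNormedModule _ f).
  - cbn [zpart]; rewrite IH, !RInt_translate by exact H.
    rewrite opp_IZR, <- !INR_IZR_INZ, S_INR.
    replace (- (1 / 2) + INR N) with (INR N - 1 / 2) by ring.
    replace (1 / 2 + INR N) with (INR N + 1 - 1 / 2) by field.
    replace (- (1 / 2) + - (INR N + 1)) with (- (INR N + 1) - 1 / 2) by ring.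
    replace (1 / 2 + - (INR N + 1)) with (- INR N - 1 / 2) by field.
    rewrite <- (@RInt_Chasles R_CompleteNormedModule f (- (INR N + 1) - 1 / 2)
                  (- INR N - 1 / 2) (INR N + 1 - 1 / 2)) by apply Hex.
    rewrite <- (@RInt_Chasles R_CompleteNormedModule f (- INR N - 1 / 2)
                  (INR N - 1 / 2) (INR N + 1 - 1 / 2)) by apply Hex.
    unfold plus; simpl; to_R_eq; ring.
Qed.

Lemma zdec_line_int (f : R -> R) : (forall x, continuous f x) -> rdec f ->
  zdec (fun n => RInt (fun x => f (x + IZR n)) (- (1 / 2)) (1 / 2)).
Proof.
  intros Hc [M H].
  apply (zdec_RInt (fun n x => f (x + IZR n)) (M * exp 1)).
  - intros n x; apply continuous_translate, Hc.
  - apply rdec_translates, H.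
Qed.

Lemma line_int_lim (f : R -> R) : (forall x, continuous f x) -> rdec f ->
  is_lim_seq (fun N => RInt f (- INR N - 1 / 2) (INR N - 1 / 2)) (line_int f).
Proof.
  intros Hc H.
  apply is_lim_seq_ext with (1 := fun N => zpart_RInt f N Hc).
  apply zpart_lim, zdec_line_int; assumption.
Qed.

Lemma rdec_scal_bounded (f g : R -> R) : rdec f -> (forall x, Rabs (g x) <= 1) ->
  rdec (fun x => f x * g x).
Proof.
  intros [M H] Hg; exists M; intros x; rewrite Rabs_mult.
  specialize (H x); specialize (Hg x).
  assert (h1 := Rabs_pos (f x)); assert (h2 := Rabs_pos (g x)); nra.
Qed.

Lemma Rabs_cos_le (x : R) : Rabs (cos x) <= 1.
Proof. apply Rabs_le, COS_bound. Qed.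

Lemma sin_IZR_PI (k : Z) : sin (PI * IZR k) = 0.
Proof. apply sin_eq_0_1; exists k; ring. Qed.

Lemma cos_2PI_add (x : R) (k : Z) : cos (x + 2 * PI * IZR k) = cos x.
Proof.
  rewrite cos_plus.
  replace (2 * PI * IZR k) with (2 * (PI * IZR k)) by ring.
  rewrite sin_2a, cos_2a_sin, sin_IZR_PI; ring.
Qed.

Lemma RInt_cos_period (j : Z) :
  RInt (fun x => cos (2 * PI * IZR j * x)) (- (1 / 2)) (1 / 2)
  = if Z.eq_dec j 0 then 1 else 0.
Proof.
  destruct (Z.eq_dec j 0) as [->|Hj].
  - rewrite (RInt_ext _ (fun _ => 1)).
    + rewrite (@RInt_const R_CompleteNormedModule); unfold scal; simpl;
        unfold mult; simpl; lra.
    + intros x _; rewrite Rmult_0_r, Rmult_0_l; apply cos_0.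
  - assert (Hj' : IZR j <> 0) by (apply not_0_IZR, Hj).
    assert (HP := PI_neq0).
    apply is_RInt_unique.
    replace 0 with (minus (sin (2 * PI * IZR j * (1 / 2)) / (2 * PI * IZR j))
                      (sin (2 * PI * IZR j * - (1 / 2)) / (2 * PI * IZR j))).
    + apply (@is_RInt_derive R_CompleteNormedModule
               (fun x => sin (2 * PI * IZR j * x) / (2 * PI * IZR j))).
      * intros x _; auto_derive; [exact I|]; field; auto.
      * intros x _; apply continuous_cos_scal.
    + replace (2 * PI * IZR j * (1 / 2)) with (PI * IZR j) by field.
      replace (2 * PI * IZR j * - (1 / 2)) with (- (PI * IZR j)) by field.
      rewrite sin_neg, sin_IZR_PI; unfold minus, plus, opp; simpl; field; auto.
Qed.

Lemma RInt_cos_cos (n k : Z) :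
  RInt (fun x => cos (2 * PI * IZR n * x) * cos (2 * PI * IZR k * x)) (- (1 / 2)) (1 / 2)
  = 1 / 2 * ((if Z.eq_dec n k then 1 else 0) + (if Z.eq_dec n (- k) then 1 else 0)).
Proof.
  set (F := fun j x => cos (2 * PI * IZR j * x)).
  assert (Hex : forall j, ex_RInt (F j) (- (1 / 2)) (1 / 2)).
  { intros j; apply ex_RInt_cont; intros; apply continuous_cos_scal. }
  rewrite (RInt_ext _ (fun x => 1 / 2 * (F (n - k)%Z x + F (n + k)%Z x))).
  - rewrite (@RInt_scal R_CompleteNormedModule (fun x => F (n - k)%Z x + F (n + k)%Z x))
      by (apply (@ex_RInt_plus R_NormedModule); apply Hex).
    rewrite (@RInt_plus R_CompleteNormedModule (F (n - k)%Z) (F (n + k)%Z)) by apply Hex.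
    unfold F; rewrite !RInt_cos_period.
    unfold scal, plus; simpl; unfold mult; simpl; to_R_eq.
    destruct (Z.eq_dec (n - k) 0), (Z.eq_dec n k); try lia;
      destruct (Z.eq_dec (n + k) 0), (Z.eq_dec n (- k)); try lia; reflexivity.
  - intros x _; unfold F; rewrite minus_IZR, plus_IZR.
    replace (2 * PI * (IZR n - IZR k) * x)
      with (2 * PI * IZR n * x - 2 * PI * IZR k * x) by ring.
    replace (2 * PI * (IZR n + IZR k) * x)
      with (2 * PI * IZR n * x + 2 * PI * IZR k * x) by ring.
    rewrite cos_minus, cos_plus; to_R_eq; field.
Qed.

(* The difference of both sides, as a function of the translation of f, is
   orthogonal to every cos (2 pi k x). *)
Lemma poisson_summation (f : R -> R) (A : Z -> R) :
  (forall x, continuous f x) -> rdec f -> zdec A ->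
  (forall k, A (- k)%Z = A k) ->
  (forall k, A k = line_int (fun x => f x * cos (2 * PI * IZR k * x))) ->
  bilateral_series (fun n => f (IZR n)) = bilateral_series A.
Proof.
  intros Hc [M Hf] [M' HA] Heven Hcoef.
  set (phi := fun n x => f (x + IZR n) - A n * cos (2 * PI * IZR n * x)).
  assert (Hpc : forall n x, continuous (phi n) x).
  { intros n x; apply (continuous_minus (fun x => f (x + IZR n))
      (fun x => A n * cos (2 * PI * IZR n * x))).
    - apply continuous_translate, Hc.
    - apply (continuous_mult (fun _ => A n) (fun x => cos (2 * PI * IZR n * x)));
        [apply continuous_const | apply continuous_cos_scal]. }
  assert (HAc : forall x, zbound M' (fun n => A n * cos (2 * PI * IZR n * x))).
  { intros x n; rewrite Rabs_mult; specialize (HA n).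
    assert (h := Rabs_cos_le (2 * PI * IZR n * x)).
    assert (h1 := Rabs_pos (A n)); assert (h2 := Rabs_pos (cos (2 * PI * IZR n * x))).
    nra. }
  assert (Hpb : forall x, Rabs x <= 1 -> zbound (M * exp 1 + M') (fun n => phi n x)).
  { intros x Hx n; unfold phi, Rminus.
    eapply Rle_trans; [apply Rabs_triang|]; rewrite Rabs_Ropp, Rmult_plus_distr_r.
    apply Rplus_le_compat; [apply (rdec_translates f M Hf x Hx) | apply HAc]. }
  set (E := fun x => bilateral_series (fun n => phi n x)).
  assert (HE : E 0 = 0).
  { apply (cos_orthogonal_0 E (4 * (M * exp 1 + M'))).
    - intros x Hx; apply (zsum_cont phi (M * exp 1 + M') Hpc Hpb); lra.
    - intros x Hx; apply zsum_bound, Hpb; lra.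
    - intros k0; rewrite INR_IZR_INZ; set (k := Z.of_nat k0).
      (* The orthogonality integral is computed termwise; [psi] is the n-th term. *)
      set (psi := fun n x => cos (2 * PI * IZR k * x) * phi n x).
      rewrite (RInt_ext _ (fun x => bilateral_series (fun n => psi n x)))
        by (intros x _; unfold psi; rewrite zsum_scal; apply Rmult_comm).
      rewrite (RInt_zsum psi (M * exp 1 + M')).
      (* [c n] is the integral of A n cos (2 pi n x) cos (2 pi k x). It vanishes unless n is k or
         -k; for k = 0 both halves fall on the same index. *)
      + set (c := fun n : Z => 1 / 2 * ((if Z.eq_dec n k then A k else 0)
                    + (if Z.eq_dec n (- k) then A (- k)%Z else 0))).
        set (g := fun x => f x * cos (2 * PI * IZR k * x)).
        assert (Hgc : forall x, continuous g x).
        { intros x; apply (continuous_mult f (fun x => cos (2 * PI * IZR k * x)));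
            [apply Hc | apply continuous_cos_scal]. }
        assert (Hgd : rdec g).
        { apply rdec_scal_bounded; [exists M; exact Hf | intros; apply Rabs_cos_le]. }
        rewrite (zsum_ext _ (fun n =>
          RInt (fun x => g (x + IZR n)) (- (1 / 2)) (1 / 2) - c n)).
        * assert (Hd1 : forall a j, zdec (fun n : Z => if Z.eq_dec n j then a else 0)).
          { intros a j; apply (zdec_ext (fun n => (fun m => if Z.eq_dec m 0 then a else 0)
                                           (n + - j)%Z)).
            - intros n; destruct (Z.eq_dec (n + - j) 0), (Z.eq_dec n j);
                try reflexivity; lia.
            - apply (zdec_add (fun m => if Z.eq_dec m 0 then a else 0)).
              exists (Rabs a); intros n; destruct (Z.eq_dec n 0) as [->|e].
              + rewrite Rabs_R0, Ropp_0, exp_0; lra.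
              + rewrite Rabs_R0; apply Rmult_le_pos;
                  [apply Rabs_pos | left; apply exp_pos]. }
          rewrite zsum_minus.
          -- unfold c; rewrite zsum_scal, zsum_plus, !zsum_single, Heven by apply Hd1.
             fold (line_int g); rewrite (Hcoef k); unfold g; to_R_eq; field.
          -- apply zdec_line_int; assumption.
          -- unfold c; apply zdec_scal, zdec_plus; apply Hd1.
        * intros n.
          rewrite (RInt_ext _ (fun x => g (x + IZR n)
            - A n * (cos (2 * PI * IZR n * x) * cos (2 * PI * IZR k * x)))).
          -- assert (Hcc : ex_RInt (fun x => cos (2 * PI * IZR n * x)
                              * cos (2 * PI * IZR k * x)) (- (1 / 2)) (1 / 2)).
             { apply ex_RInt_cont; intros x _.
               apply (continuous_mult (fun x => cos (2 * PI * IZR n * x))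
                        (fun x => cos (2 * PI * IZR k * x))); apply continuous_cos_scal. }
             rewrite (@RInt_minus R_CompleteNormedModule (fun x => g (x + IZR n))
               (fun x => A n * (cos (2 * PI * IZR n * x) * cos (2 * PI * IZR k * x)))).
             ++ rewrite (@RInt_scal R_CompleteNormedModule
                  (fun x => cos (2 * PI * IZR n * x) * cos (2 * PI * IZR k * x))) by exact Hcc.
                rewrite RInt_cos_cos; unfold minus, plus, opp, scal; simpl; unfold mult; simpl.
                to_R_eq; unfold c.
                destruct (Z.eq_dec n k) as [e1|e1], (Z.eq_dec n (- k)) as [e2|e2];
                  try rewrite <- e2; try rewrite <- e1; ring.
             ++ apply ex_RInt_cont; intros; apply continuous_translate, Hgc.
             ++ apply (@ex_RInt_scal R_NormedModule), Hcc.
          -- intros x _; unfold psi, phi, g.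
             (* Since k n is an integer, the cosine may be translated along with [f]; the pieces
                then assemble into one integral over the line. *)
             replace (2 * PI * IZR k * (x + IZR n))
               with (2 * PI * IZR k * x + 2 * PI * IZR (k * n)) by (rewrite mult_IZR; ring).
             rewrite cos_2PI_add; to_R_eq; ring.
      + intros n x; apply (continuous_mult (fun x => cos (2 * PI * IZR k * x)) (phi n));
          [apply continuous_cos_scal | apply Hpc].
      + intros x Hx n; unfold psi; rewrite Rabs_mult.
        assert (h := Hpb x Hx n); cbv beta in h.
        assert (h0 := Rabs_cos_le (2 * PI * IZR k * x)).
        assert (h1 := Rabs_pos (phi n x));
          assert (h2 := Rabs_pos (cos (2 * PI * IZR k * x))); nra. }
  unfold E, phi in HE.
  rewrite zsum_minus in HE.
  - apply Rminus_diag_uniq; rewrite <- HE; f_equal; apply zsum_ext; intros n.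
    + f_equal; ring.
    + rewrite Rmult_0_r, cos_0; ring.
  - exists (M * exp 1); apply rdec_translates; [exact Hf | rewrite Rabs_R0; lra].
  - exists M'; apply HAc.
Qed.

(** * Gaussian integrals *)

(** Differentiating under the integral gives the integral of dh/dx, that is the boundary term h b -
    h a; the mean value theorem concludes. *)
Lemma RInt_param_bound (g dg h : R -> R -> R) (p0 p1 a b K : R) :
  p0 <= p1 ->
  (forall p x, continuous (g p) x) ->
  (forall p x, is_derive (fun p => g p x) p (dg p x)) ->
  (forall p x, is_derive (h p) x (dg p x)) ->
  (forall p x, continuity_2d_pt dg p x) ->
  (forall p, p0 <= p <= p1 -> Rabs (h p b - h p a) <= K) ->
  Rabs (RInt (g p1) a b - RInt (g p0) a b) <= K * (p1 - p0).
Proof.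
  intros Hp Hc Hg Hh Hd Hb.
  assert (HD : forall p x, Derive (fun p => g p x) p = dg p x).
  { intros p x; apply is_derive_unique, Hg. }
  assert (Hder : forall p, is_derive (fun p => RInt (g p) a b) p (h p b - h p a)).
  { intros p.
    assert (E : RInt (fun x => Derive (fun p => g p x) p) a b = h p b - h p a).
    { rewrite (RInt_ext _ (dg p)) by (intros; apply HD).
      apply is_RInt_unique.
      apply (@is_RInt_derive R_CompleteNormedModule (h p)).
      - intros x _; apply Hh.
      - intros x _ P HP.
        assert (Hd' := proj1 (continuity_2d_pt_filterlim dg p x) (Hd p x) P HP).
        destruct Hd' as [eps He]; exists eps; intros y Hy.
        apply (He (p, y)); split; [apply ball_center | exact Hy]. }
    rewrite <- E.
    apply (is_derive_RInt_param g a b p).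
    - exists (mkposreal 1 Rlt_0_1); intros q _ t _; eexists; apply Hg.
    - intros t _; apply continuity_2d_pt_ext with dg; [intros; symmetry; apply HD | apply Hd].
    - exists (mkposreal 1 Rlt_0_1); intros q _; apply ex_RInt_cont; intros; apply Hc. }
  destruct (MVT_gen (fun p => RInt (g p) a b) p0 p1 (fun p => h p b - h p a))
    as (c & Hc1 & Hc2).
  - intros p _; apply Hder.
  - intros p _; apply continuity_pt_filterlim.
    exact (ex_derive_continuous (fun p => RInt (g p) a b) p (ex_intro _ _ (Hder p))).
  - rewrite Hc2, Rabs_mult, (Rabs_pos_eq (p1 - p0)) by lra.
    apply Rmult_le_compat_r; [lra|]. apply Hb.
    rewrite Rmin_left, Rmax_right in Hc1 by lra; exact Hc1.
Qed.

(* If d/dp g = d/dx h with h vanishing at infinity, the integral of g over the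
   line does not depend on p. *)
Lemma line_int_deform (g dg h : R -> R -> R) (p0 p1 M : R) :
  p0 <= p1 ->
  (forall p x, continuous (g p) x) ->
  (forall p x, is_derive (fun p => g p x) p (dg p x)) ->
  (forall p x, is_derive (h p) x (dg p x)) ->
  (forall p x, continuity_2d_pt dg p x) ->
  (forall p x, p0 <= p <= p1 -> Rabs (g p x) <= M * exp (- Rabs x)) ->
  (forall p x, p0 <= p <= p1 -> Rabs (h p x) <= M * exp (- Rabs x)) ->
  line_int (g p1) = line_int (g p0).
Proof.
  intros Hp Hc Hg Hh Hd Hbg Hbh.
  assert (HM : 0 <= M).
  { specialize (Hbg p0 0 ltac:(lra)); rewrite Rabs_R0, Ropp_0, exp_0 in Hbg.
    assert (h0 := Rabs_pos (g p0 0)); lra. }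
  assert (Hr : forall p, p0 <= p <= p1 -> rdec (g p)).
  { intros p Hpp; exists M; intros x; apply Hbg, Hpp. }
  assert (L := is_lim_seq_minus' _ _ _ _ (line_int_lim (g p1) (Hc p1) (Hr p1 ltac:(lra)))
                 (line_int_lim (g p0) (Hc p0) (Hr p0 ltac:(lra)))).
  assert (L0 : is_lim_seq (fun N => RInt (g p1) (- INR N - 1 / 2) (INR N - 1 / 2)
                 - RInt (g p0) (- INR N - 1 / 2) (INR N - 1 / 2)) 0).
  { apply is_lim_seq_abs_0.
    apply is_lim_seq_le_le with (fun _ => 0)
      (fun N => 2 * M * exp (1 / 2) * (p1 - p0) * exp (- 1) ^ N).
    - intros N; split; [apply Rabs_pos|].
      replace (2 * M * exp (1 / 2) * (p1 - p0) * exp (- 1) ^ N)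
        with (2 * M * exp (1 / 2) * exp (- 1) ^ N * (p1 - p0)) by ring.
      apply (RInt_param_bound g dg h); try assumption.
      intros p Hpp.
      assert (He : forall x, INR N - 1 / 2 <= Rabs x ->
                     Rabs (h p x) <= M * exp (1 / 2) * exp (- 1) ^ N).
      { intros x Hx; eapply Rle_trans; [apply Hbh, Hpp|].
        rewrite Rmult_assoc, <- exp_opp_INR, <- exp_plus.
        apply Rmult_le_compat_l; [exact HM|]. apply exp_le; lra. }
      assert (HN := pos_INR N).
      assert (h1 := He (INR N - 1 / 2) (Rle_abs _)).
      assert (h2 := He (- INR N - 1 / 2) ltac:(rewrite Rabs_left by lra; lra)).
      unfold Rminus at 1; eapply Rle_trans; [apply Rabs_triang|]; rewrite Rabs_Ropp; lra.
    - apply is_lim_seq_const.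
    - apply geom_lim. }
  apply is_lim_seq_unique in L; apply is_lim_seq_unique in L0.
  rewrite L in L0; injection L0; lra.
Qed.

(* Real part of exp (i eta - pi (a + i b) (X + i Y) ^ 2). *)
Definition gauss (a b eta X Y : R) : R :=
  exp (- PI * (a * (X ^ 2 - Y ^ 2) - 2 * b * X * Y))
  * cos (- PI * (b * (X ^ 2 - Y ^ 2) + 2 * a * X * Y) + eta).

Lemma cos_add_PI2 (x : R) : cos (x + PI / 2) = - sin x.
Proof. rewrite cos_plus, cos_PI2, sin_PI2; ring. Qed.

Ltac cont2 :=
  match goal with
  | |- continuous (fun z => fst z) _ => apply continuous_fst
  | |- continuous (fun z => snd z) _ => apply continuous_snd
  | |- continuous (fun z => ?c) _ => apply continuous_const
  | |- continuous (fun z => @?f z + @?g z) _ => apply (continuous_plus f g); cont2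
  | |- continuous (fun z => @?f z - @?g z) _ => apply (continuous_minus f g); cont2
  | |- continuous (fun z => @?f z * @?g z) _ => apply (continuous_mult f g); cont2
  | |- continuous (fun z => - @?f z) _ =>
      apply (@continuous_opp _ R_AbsRing R_NormedModule f); cont2
  | |- continuous (fun z => exp (@?f z)) _ =>
      apply (continuous_comp f exp); [cont2 | apply continuous_exp]
  | |- continuous (fun z => cos (@?f z)) _ =>
      apply (continuous_comp f cos); [cont2 | apply continuous_cos]
  | |- continuous (fun z => @?f z ^ 2) _ =>
      apply (continuous_mult f (fun z => f z * 1));
      [cont2 | apply (continuous_mult f (fun _ => 1)); [cont2 | apply continuous_const]]
  | |- continuous (fun z => z) _ => apply continuous_id
  end.

Lemma gauss_bound (a b r : R) : 0 < a -> 0 <= r ->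
  exists M, forall eta X Y, Rabs Y <= r ->
    Rabs (gauss a b eta X Y) <= M * exp (- Rabs X).
Proof.
  intros Ha Hr; assert (HP := PI_RGT_0).
  (* [be] collects the coefficients of |X| that the Gaussian must absorb: 2 pi |b| r from the cross
     term and 1 from the claimed exp (-|X|). Completing the square in |X| yields the constant. *)
  set (al := PI * a); set (be := 2 * PI * Rabs b * r + 1).
  assert (Hal : 0 < al) by (apply Rmult_lt_0_compat; lra).
  exists (exp (be ^ 2 / (4 * al) + al * r ^ 2)); intros eta X Y HY.
  unfold gauss; rewrite Rabs_mult, (Rabs_pos_eq (exp _)) by (left; apply exp_pos).
  rewrite <- exp_plus.
  eapply Rle_trans with (exp (- PI * (a * (X ^ 2 - Y ^ 2) - 2 * b * X * Y)) * 1).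
  { apply Rmult_le_compat_l; [left; apply exp_pos | apply Rabs_cos_le]. }
  rewrite Rmult_1_r; apply exp_le.
  assert (h1 : b * X * Y <= Rabs b * Rabs X * r).
  { eapply Rle_trans; [apply Rle_abs|]; rewrite !Rabs_mult.
    apply Rmult_le_compat_l; [|exact HY].
    apply Rmult_le_pos; apply Rabs_pos. }
  assert (h2 : Y ^ 2 <= r ^ 2).
  { rewrite <- (pow2_abs Y); apply pow_incr; split; [apply Rabs_pos | exact HY]. }
  assert (h3 : 0 <= (2 * al * Rabs X - be) ^ 2 / (4 * al)).
  { apply Rmult_le_pos; [apply pow2_ge_0|].
    left; apply Rinv_0_lt_compat; lra. }
  replace ((2 * al * Rabs X - be) ^ 2 / (4 * al))
    with (al * X ^ 2 - be * Rabs X + be ^ 2 / (4 * al)) in h3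
    by (rewrite <- (pow2_abs X); field; lra).
  assert (h4 : al * Y ^ 2 <= al * r ^ 2) by (apply Rmult_le_compat_l; lra).
  assert (h5 : 2 * PI * (b * X * Y) <= 2 * PI * (Rabs b * Rabs X * r))
    by (apply Rmult_le_compat_l; lra).
  unfold be, al in *; lra.
Qed.

Lemma gauss_cont (a b eta v w : R) (x : R) :
  continuous (fun x => gauss a b eta (x + v) w) x.
Proof. unfold gauss; cont2. Qed.

Lemma gauss_rdec (a b eta v w : R) : 0 < a -> rdec (fun x => gauss a b eta (x + v) w).
Proof.
  intros Ha; destruct (gauss_bound a b (Rabs w) Ha (Rabs_pos w)) as [M HM].
  exists (M * exp (Rabs v)); intros x.
  eapply Rle_trans; [apply HM, Rle_refl|].
  assert (HM0 : 0 <= M).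
  { specialize (HM 0 0 0); rewrite Rabs_R0, Ropp_0, exp_0 in HM.
    specialize (HM (Rabs_pos w)); assert (h := Rabs_pos (gauss a b 0 0 0)); lra. }
  rewrite Rmult_assoc, <- exp_plus; apply Rmult_le_compat_l; [exact HM0|].
  apply exp_le.
  assert (h := Rabs_triang (x + v) (- v)); rewrite Rabs_Ropp in h.
  replace (x + v + - v) with x in h by ring; lra.
Qed.

(* Moving the line of integration: [gauss] is the real part of an entire function,
   so its derivative in any complex direction is an x-derivative. *)
Lemma line_int_gauss_shift (a b eta v w : R) : 0 < a ->
  line_int (fun x => gauss a b eta (x + v) w) = line_int (fun x => gauss a b eta x 0).
Proof.
  intros Ha.
  set (g := fun p x => gauss a b eta (x + p * v) (p * w)).
  (* With G the entire function behind [gauss] and z = x + p (v + i w), [h] is the real part of (v +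
     i w) G(z), because the phase pi/2 stands for a factor i. Then [dg] is the real part of (v + i
     w) G'(z), which is both dg/dp and dh/dx. *)
  set (h := fun p x => v * gauss a b eta (x + p * v) (p * w)
                       + w * gauss a b (eta + PI / 2) (x + p * v) (p * w)).
  set (dg := fun p x =>
    - (2) * PI * (a * (x + p * v) - b * (p * w))
      * (v * gauss a b eta (x + p * v) (p * w)
         + w * gauss a b (eta + PI / 2) (x + p * v) (p * w))
    - 2 * PI * (b * (x + p * v) + a * (p * w))
      * (v * gauss a b (eta + PI / 2) (x + p * v) (p * w)
         - w * gauss a b eta (x + p * v) (p * w))).
  assert (Hgc : forall p x, continuous (g p) x) by (intros; apply gauss_cont).
  destruct (gauss_bound a b (Rabs w) Ha (Rabs_pos w)) as [M HM].
  assert (HM0 : 0 <= M).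
  { specialize (HM 0 0 0); rewrite Rabs_R0, Ropp_0, exp_0 in HM.
    specialize (HM (Rabs_pos w)); assert (h0 := Rabs_pos (gauss a b 0 0 0)); lra. }
  assert (HB : forall p x e, 0 <= p <= 1 ->
    Rabs (gauss a b e (x + p * v) (p * w)) <= M * exp (Rabs v) * exp (- Rabs x)).
  { intros p x e Hp.
    assert (Hpv : forall t, Rabs (p * t) <= Rabs t).
    { intros t; rewrite Rabs_mult, (Rabs_pos_eq p) by lra.
      assert (h0 := Rabs_pos t); nra. }
    eapply Rle_trans; [apply HM, Hpv|].
    rewrite Rmult_assoc, <- exp_plus; apply Rmult_le_compat_l; [exact HM0|].
    apply exp_le.
    assert (h0 := Rabs_triang (x + p * v) (- (p * v))); rewrite Rabs_Ropp in h0.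
    replace (x + p * v + - (p * v)) with x in h0 by ring.
    specialize (Hpv v); lra. }
  transitivity (line_int (g 1)).
  { apply line_int_ext; intros x; unfold g; rewrite !Rmult_1_l; reflexivity. }
  transitivity (line_int (g 0)).
  - apply (line_int_deform g dg h 0 1 (M * exp (Rabs v) * (1 + Rabs v + Rabs w)));
      try assumption; try lra.
    + intros p x; unfold g, dg, gauss; rewrite <- Rplus_assoc, cos_add_PI2.
      auto_derive; [exact I|]; simpl pow; unfold Rminus; ring.
    + intros p x; unfold h, dg, gauss; rewrite <- !Rplus_assoc, cos_add_PI2.
      apply is_derive_ext with (fun x =>
        exp (- PI * (a * ((x + p * v) ^ 2 - (p * w) ^ 2) - 2 * b * (x + p * v) * (p * w)))
        * (v * cos (- PI * (b * ((x + p * v) ^ 2 - (p * w) ^ 2)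
                     + 2 * a * (x + p * v) * (p * w)) + eta)
           - w * sin (- PI * (b * ((x + p * v) ^ 2 - (p * w) ^ 2)
                     + 2 * a * (x + p * v) * (p * w)) + eta))).
      * intros t; rewrite <- !Rplus_assoc, cos_add_PI2; to_R_eq; ring.
      * auto_derive; [exact I|]; simpl pow; unfold Rminus; ring.
    + intros p x; apply continuity_2d_pt_filterlim; unfold dg, gauss.
      match goal with |- filterlim ?f _ _ => change (continuous f (p, x)) end.
      cont2.
    + intros p x Hp; eapply Rle_trans; [apply HB, Hp|].
      apply Rmult_le_compat_r; [left; apply exp_pos|].
      assert (0 <= M * exp (Rabs v))
        by (apply Rmult_le_pos; [exact HM0 | left; apply exp_pos]).
      assert (h1 := Rabs_pos v); assert (h2 := Rabs_pos w); nra.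
    + intros p x Hp; unfold h.
      eapply Rle_trans; [apply Rabs_triang|]; rewrite !Rabs_mult.
      assert (h1 := HB p x eta Hp); assert (h2 := HB p x (eta + PI / 2) Hp).
      assert (h3 := Rabs_pos v); assert (h4 := Rabs_pos w).
      assert (h5 : 0 <= M * exp (Rabs v) * exp (- Rabs x)).
      { repeat apply Rmult_le_pos; try exact HM0; left; apply exp_pos. }
      apply (Rmult_le_compat_l _ _ _ h3) in h1.
      apply (Rmult_le_compat_l _ _ _ h4) in h2. nra.
  - apply line_int_ext; intros x; unfold g; rewrite !Rmult_0_l, Rplus_0_r; reflexivity.
Qed.

(** * Poisson summation for Gaussians *)

Lemma exp_sq_bound (c x : R) : 0 < c ->
  exists M, 0 <= M /\
    forall n : Z, exp (- c * (IZR n + x) ^ 2) <= M * exp (- 2 * Rabs (IZR n)).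
Proof.
  (* The constant comes from expanding (c |n + x| - 1)^2 / c >= 0 and from |n| <= |n + x| + |x|. *)
  intros Hc; exists (exp (/ c + 2 * Rabs x)); split; [left; apply exp_pos|].
  intros n; rewrite <- exp_plus; apply exp_le.
  assert (h := Rabs_triang (IZR n + x) (- x)); rewrite Rabs_Ropp in h.
  replace (IZR n + x + - x) with (IZR n) in h by ring.
  assert (h1 : 0 <= (c * Rabs (IZR n + x) - 1) ^ 2 / c).
  { apply Rmult_le_pos; [apply pow2_ge_0 | left; apply Rinv_0_lt_compat, Hc]. }
  replace ((c * Rabs (IZR n + x) - 1) ^ 2 / c)
    with (c * (IZR n + x) ^ 2 - 2 * Rabs (IZR n + x) + / c) in h1
    by (rewrite <- (pow2_abs (IZR n + x)); field; lra).
  lra.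
Qed.

Lemma exp_sq_zdec (c x K : R) (f : Z -> R) : 0 < c ->
  (forall n, Rabs (f n) <= K * exp (- c * (IZR n + x) ^ 2)) -> zdec f.
Proof.
  intros Hc H; destruct (exp_sq_bound c x Hc) as (M & HM & HB).
  assert (HK : 0 <= K).
  { specialize (H 0%Z); assert (h := Rabs_pos (f 0%Z)).
    assert (h1 := exp_pos (- c * (IZR 0 + x) ^ 2)); nra. }
  exists (K * M); intros n; eapply Rle_trans; [apply H|].
  rewrite Rmult_assoc; apply Rmult_le_compat_l; [exact HK|].
  eapply Rle_trans; [apply HB|]; apply Rmult_le_compat_l; [exact HM|].
  apply exp_le; assert (h := Rabs_pos (IZR n)); lra.
Qed.

Lemma line_int_minus_scal (c d : R) (f g : R -> R) :
  (forall x, continuous f x) -> rdec f -> (forall x, continuous g x) -> rdec g ->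
  line_int (fun x => c * f x - d * g x) = c * line_int f - d * line_int g.
Proof.
  intros Hf Hf' Hg Hg'; unfold line_int.
  rewrite <- !zsum_scal, <- zsum_minus
    by (apply zdec_scal, zdec_line_int; assumption).
  apply zsum_ext; intros n.
  assert (Hex : forall h : R -> R, (forall x, continuous h x) ->
            ex_RInt (fun x => h (x + IZR n)) (- (1 / 2)) (1 / 2)).
  { intros h Hh; apply ex_RInt_cont; intros; apply continuous_translate, Hh. }
  rewrite (@RInt_minus R_CompleteNormedModule (fun x => c * f (x + IZR n))
             (fun x => d * g (x + IZR n)))
    by (apply (@ex_RInt_scal R_NormedModule); apply Hex; assumption).
  rewrite (@RInt_scal R_CompleteNormedModule (fun x => f (x + IZR n))) by (apply Hex, Hf).
  rewrite (@RInt_scal R_CompleteNormedModule (fun x => g (x + IZR n))) by (apply Hex, Hg).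
  reflexivity.
Qed.

Definition gauss_int (a b eta : R) : R := line_int (fun x => gauss a b eta x 0).

(** The phases 0 and -pi/2 give the real and imaginary parts of the complex Gaussian integral; any
    other phase is a rotation of these. *)
Lemma gauss_int_rot (a b eta : R) : 0 < a ->
  gauss_int a b eta
  = cos eta * gauss_int a b 0 - sin eta * gauss_int a b (- (PI / 2)).
Proof.
  intros Ha.
  assert (Hc : forall e x, continuous (fun x => gauss a b e x 0) x).
  { intros e x; apply continuous_ext with (fun x => gauss a b e (x + 0) 0).
    - intros t; rewrite Rplus_0_r; reflexivity.
    - apply gauss_cont. }
  assert (Hr : forall e, rdec (fun x => gauss a b e x 0)).
  { intros e; destruct (gauss_rdec a b e 0 0 Ha) as [M HM]; exists M; intros x.
    specialize (HM x); rewrite Rplus_0_r in HM; exact HM. }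
  unfold gauss_int; rewrite <- line_int_minus_scal by (try apply Hc; apply Hr).
  apply line_int_ext; intros x; unfold gauss; rewrite !cos_plus, cos_neg, sin_neg,
    cos_PI2, sin_PI2, cos_0, sin_0; ring.
Qed.

(* Completing the square: a linear phase is an imaginary translation by
   i u / s of the Gaussian exp (- pi s X^2), s = a + i b. *)
Lemma gauss_complete_square (a b u th X : R) : 0 < a ->
  exp (- PI * a * X ^ 2) * cos (- PI * b * X ^ 2 - 2 * PI * u * X + th)
  = exp (- PI * (a / (a ^ 2 + b ^ 2)) * u ^ 2)
    * gauss a b (th - PI * (- b / (a ^ 2 + b ^ 2)) * u ^ 2)
        (X + u * b / (a ^ 2 + b ^ 2)) (u * a / (a ^ 2 + b ^ 2)).
Proof.
  intros Ha; assert (HD : a ^ 2 + b ^ 2 <> 0) by nra.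
  unfold gauss; rewrite <- Rmult_assoc, <- exp_plus.
  f_equal; f_equal; field; exact HD.
Qed.

Lemma gauss_cos_rdec (a x : R) (th : R -> R) : 0 < a ->
  rdec (fun t => exp (- PI * a * (t + x) ^ 2) * cos (th t)).
Proof.
  intros Ha; apply rdec_scal_bounded; [|intros; apply Rabs_cos_le].
  destruct (gauss_rdec a 0 0 x 0 Ha) as [M HM]; exists M; intros t.
  specialize (HM t); unfold gauss in HM.
  replace (- PI * (0 * ((t + x) ^ 2 - 0 ^ 2) + 2 * a * (t + x) * 0) + 0) with 0 in HM
    by ring.
  replace (- PI * (a * ((t + x) ^ 2 - 0 ^ 2) - 2 * 0 * (t + x) * 0))
    with (- PI * a * (t + x) ^ 2) in HM by ring.
  rewrite cos_0, Rmult_1_r in HM; exact HM.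
Qed.

(** The dual parameter a' + i b' is 1 / (a + i b). The Gaussian integral stays unevaluated, with the
    whole phase of the k-th dual term as its argument. *)
Lemma poisson_gauss (a b x y eta : R) : 0 < a ->
  let a' := a / (a ^ 2 + b ^ 2) in
  let b' := - b / (a ^ 2 + b ^ 2) in
  bilateral_series (fun n => exp (- PI * a * (IZR n + x) ^ 2)
    * cos (- PI * b * (IZR n + x) ^ 2 - 2 * PI * y * (IZR n + x) + eta))
  = bilateral_series (fun k => exp (- PI * a' * (IZR k + y) ^ 2)
    * gauss_int a b (eta + 2 * PI * IZR k * x - PI * b' * (IZR k + y) ^ 2)).
Proof.
  intros Ha a' b'.
  assert (HP := PI_RGT_0).
  assert (Ha' : 0 < a') by (apply Rdiv_lt_0_compat; nra).
  set (f := fun t => exp (- PI * a * (t + x) ^ 2)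
    * cos (- PI * b * (t + x) ^ 2 - 2 * PI * y * (t + x) + eta)).
  set (B := fun k : Z => exp (- PI * a' * (IZR k + y) ^ 2)
    * gauss_int a b (eta + 2 * PI * IZR k * x - PI * b' * (IZR k + y) ^ 2)).
  assert (HB : zdec B).
  { apply (exp_sq_zdec (PI * a') y
             (Rabs (gauss_int a b 0) + Rabs (gauss_int a b (- (PI / 2))))).
    - apply Rmult_lt_0_compat; assumption.
    - intros n; unfold B; rewrite Rabs_mult, (Rabs_pos_eq (exp _)), Rmult_comm
        by (left; apply exp_pos).
      replace (- PI * a') with (- (PI * a')) by ring.
      apply Rmult_le_compat_r; [left; apply exp_pos|].
      rewrite gauss_int_rot by exact Ha.
      unfold Rminus; eapply Rle_trans; [apply Rabs_triang|].
      rewrite Rabs_Ropp, !Rabs_mult.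
      set (th := _ + - _); assert (h1 := Rabs_cos_le th).
      assert (h2 : Rabs (sin th) <= 1) by (apply Rabs_le, SIN_bound).
      assert (h3 := Rabs_pos (gauss_int a b 0)).
      assert (h4 := Rabs_pos (gauss_int a b (- (PI / 2)))); nra. }
  assert (HBo : zdec (fun k => B (- k)%Z)).
  { apply (zdec_ext (fun k => B (0 - k)%Z)); [intros; f_equal; lia|].
    apply zdec_sub, HB. }
  assert (Hfc : forall t, continuous f t).
  { intros t; unfold f; cont2. }
  assert (Hfr : rdec f).
  { apply gauss_cos_rdec, Ha. }
  (* Only cosine coefficients enter [poisson_summation], and [B] need not be even: its
     symmetrization is the cosine transform of [f] and has the same sum. *)
  transitivity (bilateral_series (fun k => 1 / 2 * (B k + B (- k)%Z))).
  - apply (poisson_summation f); try assumption.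
    + apply zdec_scal, zdec_plus; assumption.
    + intros k; rewrite Z.opp_involutive; ring.
    + intros k.
      assert (E : forall j : Z,
        B j = line_int (fun t => exp (- PI * a * (t + x) ^ 2)
          * cos (- PI * b * (t + x) ^ 2 - 2 * PI * (IZR j + y) * (t + x)
                 + (eta + 2 * PI * IZR j * x)))).
      { intros j; unfold B; fold a' b'.
        set (v := (IZR j + y) * b / (a ^ 2 + b ^ 2)).
        set (w := (IZR j + y) * a / (a ^ 2 + b ^ 2)).
        set (th := eta + 2 * PI * IZR j * x - PI * b' * (IZR j + y) ^ 2).
        unfold gauss_int; rewrite <- (line_int_gauss_shift a b th (x + v) w Ha).
        (* A zero multiple is subtracted so that [line_int_minus_scal] acts as compatibility with
           scalars. *)
        rewrite <- (Rminus_0_r (_ * line_int _)).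
        rewrite <- (Rmult_0_l (line_int (fun t => gauss a b th (t + (x + v)) w))).
        rewrite <- line_int_minus_scal
          by (try (intros; apply gauss_cont); apply gauss_rdec, Ha).
        apply line_int_ext; intros t; rewrite gauss_complete_square by exact Ha.
        fold a' b' w v; rewrite <- Rplus_assoc; unfold th; ring. }
      set (F := fun j t => exp (- PI * a * (t + x) ^ 2)
          * cos (- PI * b * (t + x) ^ 2 - 2 * PI * (IZR j + y) * (t + x)
                 + (eta + 2 * PI * IZR j * x))) in E.
      assert (HFc : forall j t, continuous (F j) t) by (intros; unfold F; cont2).
      assert (HFr : forall j, rdec (F j)).
      { intros j; apply gauss_cos_rdec, Ha. }
      rewrite (E k), (E (- k)%Z); fold (F k) (F (- k)%Z).
      replace (1 / 2 * (line_int (F k) + line_int (F (- k)%Z)))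
        with (1 / 2 * line_int (F k) - (- (1 / 2)) * line_int (F (- k)%Z)) by ring.
      rewrite <- line_int_minus_scal by auto.
      apply line_int_ext; intros t; unfold F, f; rewrite opp_IZR.
      set (om := - PI * b * (t + x) ^ 2 - 2 * PI * y * (t + x) + eta).
      replace (- PI * b * (t + x) ^ 2 - 2 * PI * (IZR k + y) * (t + x)
               + (eta + 2 * PI * IZR k * x)) with (om - 2 * PI * IZR k * t)
        by (unfold om; ring).
      replace (- PI * b * (t + x) ^ 2 - 2 * PI * (- IZR k + y) * (t + x)
               + (eta + 2 * PI * - IZR k * x)) with (om + 2 * PI * IZR k * t)
        by (unfold om; ring).
      rewrite cos_plus, cos_minus; field.
  - rewrite zsum_scal, zsum_plus by assumption.
    rewrite (zsum_ext (fun k => B (- k)%Z) (fun k => B (0 - k)%Z))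
      by (intros; f_equal; lia).
    rewrite (zsum_sub B 0 HB); field.
Qed.

Lemma zsum_pos (f : Z -> R) : zdec f -> (forall n, 0 <= f n) -> 0 < f 0%Z ->
  0 < bilateral_series f.
Proof.
  intros H Hn H0.
  apply Rlt_le_trans with (f 0%Z); [exact H0|].
  assert (L := zpart_lim f H); apply is_lim_seq_incr_1 in L.
  refine (is_lim_seq_le (fun _ => f 0%Z) _ _ _ _ (is_lim_seq_const _) L).
  induction n as [|n IH].
  - simpl; assert (h := Hn (-1)%Z); simpl in h; lra.
  - remember (S n) as m; cbn [zpart].
    assert (h1 := Hn (Z.of_nat m)); assert (h2 := Hn (- Z.of_nat (S m))%Z); lra.
Qed.

Lemma poisson_real (t : R) : 0 < t ->
  bilateral_series (fun n => exp (- PI * t * IZR n ^ 2))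
  = gauss_int t 0 0 * bilateral_series (fun n => exp (- PI * / t * IZR n ^ 2)).
Proof.
  intros Ht; assert (h := poisson_gauss t 0 0 0 0 Ht); cbv zeta in h.
  rewrite <- zsum_scal.
  etransitivity; [|etransitivity; [exact h|]]; apply zsum_ext; intros n;
    rewrite Rplus_0_r.
  - replace (- PI * 0 * IZR n ^ 2 - 2 * PI * 0 * IZR n + 0) with 0 by ring.
    rewrite cos_0; ring.
  - replace (0 + 2 * PI * IZR n * 0 - PI * (- 0 / (t ^ 2 + 0 ^ 2)) * IZR n ^ 2) with 0
      by (field; nra).
    replace (t / (t ^ 2 + 0 ^ 2)) with (/ t) by (field; nra).
    ring.
Qed.

Lemma exp_sq_zdec0 (c x : R) : 0 < c -> zdec (fun n => exp (- c * (IZR n + x) ^ 2)).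
Proof.
  intros Hc; apply (exp_sq_zdec c x 1 _ Hc); intros n.
  rewrite Rabs_pos_eq by (left; apply exp_pos); lra.
Qed.

(** The parameter 1 is self-dual, so the positive theta sum equals itself times the integral. *)
Lemma gauss_int_1 : gauss_int 1 0 0 = 1.
Proof.
  assert (h := poisson_real 1 Rlt_0_1); rewrite Rinv_1 in h.
  assert (HP := PI_RGT_0).
  set (S := bilateral_series _) in h.
  assert (HS : 0 < S).
  { apply zsum_pos; try (intros; left; apply exp_pos); [|apply exp_pos].
    apply (zdec_ext (fun n => exp (- PI * (IZR n + 0) ^ 2))).
    - intros n; rewrite Rplus_0_r, Rmult_1_r; reflexivity.
    - apply exp_sq_zdec0, HP. }
  nra.
Qed.

(** Scaling invariance by deformation in p = ln t: for g = exp (p/2) exp (-pi e^p x^2), both dg/dp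
    and d/dx (x g / 2) equal (1/2 - pi e^p x^2) g. *)
Lemma gauss_int_real (t : R) : 1 <= t -> sqrt t * gauss_int t 0 0 = 1.
Proof.
  intros Ht; rewrite <- gauss_int_1.
  set (g := fun p x => exp (p / 2) * exp (- PI * exp p * x ^ 2)).
  set (h := fun p x => x / 2 * g p x).
  set (dg := fun p x => (1 / 2 - PI * exp p * x ^ 2) * g p x).
  assert (Hs : exp (ln t / 2) = sqrt t).
  { rewrite <- (sqrt_Rsqr (exp (ln t / 2))) by (left; apply exp_pos).
    f_equal; unfold Rsqr; rewrite <- exp_plus.
    replace (ln t / 2 + ln t / 2) with (ln t) by field; apply exp_ln; lra. }
  assert (HP := PI_RGT_0).
  assert (Hl : 0 <= ln t) by (rewrite <- ln_1; apply ln_le; lra).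
  (* From x^2 >= 2 |x| - 1. The rate 2 leaves a factor exp (-|x|) once the factor x/2 of [h] is
     absorbed. *)
  assert (Hg : forall p x, 0 <= p <= ln t ->
            0 <= g p x <= sqrt t * exp 1 * exp (- 2 * Rabs x)).
  { intros p x Hp; unfold g; split.
    - apply Rmult_le_pos; left; apply exp_pos.
    - rewrite (Rmult_assoc (sqrt t)), <- (exp_plus 1).
      apply Rmult_le_compat; try (left; apply exp_pos).
      + rewrite <- Hs; apply exp_le; lra.
      + apply exp_le.
        assert (h1 := exp_ineq1_le p); assert (h2 := PI2_1).
        assert (h3 : 0 <= (Rabs x - 1) ^ 2) by apply pow2_ge_0.
        assert (h4 : 1 * x ^ 2 <= PI * exp p * x ^ 2).
        { apply Rmult_le_compat_r; [apply pow2_ge_0 | nra]. }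
        replace ((Rabs x - 1) ^ 2) with (x ^ 2 - 2 * Rabs x + 1) in h3
          by (rewrite <- (pow2_abs x); ring).
        lra. }
  transitivity (line_int (g (ln t))).
  - transitivity (sqrt t * gauss_int t 0 0 - 0 * gauss_int t 0 0); [ring|].
    unfold gauss_int.
    assert (Hc : forall x, continuous (fun x => gauss t 0 0 x 0) x)
      by (intros x; unfold gauss; cont2).
    assert (Hr : rdec (fun x => gauss t 0 0 x 0)).
    { destruct (gauss_rdec t 0 0 0 0 ltac:(lra)) as [K HK]; exists K; intros x.
      specialize (HK x); rewrite Rplus_0_r in HK; exact HK. }
    rewrite <- line_int_minus_scal by (try exact Hc; exact Hr).
    apply line_int_ext; intros x; unfold g, gauss; rewrite Hs, exp_ln by lra.
    replace (- PI * (0 * (x ^ 2 - 0 ^ 2) + 2 * t * x * 0) + 0) with 0 by ring.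
    replace (- PI * (t * (x ^ 2 - 0 ^ 2) - 2 * 0 * x * 0)) with (- PI * t * x ^ 2) by ring.
    rewrite cos_0; ring.
  - transitivity (line_int (g 0)).
    + apply (line_int_deform g dg h 0 (ln t) (sqrt t * exp 1)); try assumption.
      * intros p x; unfold g; cont2.
      * intros p x; unfold dg, g; auto_derive; [exact I|]; simpl pow; unfold Rdiv; field.
      * intros p x; unfold h, dg, g; auto_derive; [exact I|]; simpl pow; field.
      * intros p x; apply continuity_2d_pt_filterlim; unfold dg, g.
        match goal with |- filterlim ?f _ _ => change (continuous f (p, x)) end.
        unfold Rdiv; cont2.
      * intros p x Hp; assert (h1 := Hg p x Hp); rewrite Rabs_pos_eq by lra.
        eapply Rle_trans; [apply h1|]; apply Rmult_le_compat_l.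
        -- apply Rmult_le_pos; [apply sqrt_pos | left; apply exp_pos].
        -- apply exp_le; assert (h2 := Rabs_pos x); lra.
      * intros p x Hp; assert (h1 := Hg p x Hp); unfold h.
        rewrite Rabs_mult, (Rabs_pos_eq (g p x)) by lra.
        replace (- Rabs x) with (Rabs x + - 2 * Rabs x) by ring.
        rewrite exp_plus.
        assert (h2 := exp_ineq1_le (Rabs x)); assert (h3 := Rabs_pos x).
        unfold Rdiv; rewrite Rabs_mult, (Rabs_pos_eq (/ 2)) by lra.
        assert (h4 : Rabs x * / 2 <= exp (Rabs x)) by lra.
        replace (sqrt t * exp 1 * (exp (Rabs x) * exp (- 2 * Rabs x)))
          with (exp (Rabs x) * (sqrt t * exp 1 * exp (- 2 * Rabs x))) by ring.
        apply Rmult_le_compat; lra.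
    + apply line_int_ext; intros x; unfold g, gauss.
      replace (0 / 2) with 0 by field; rewrite exp_0.
      replace (- PI * (0 * (x ^ 2 - 0 ^ 2) + 2 * 1 * x * 0) + 0) with 0 by ring.
      replace (- PI * (1 * (x ^ 2 - 0 ^ 2) - 2 * 0 * x * 0)) with (- PI * 1 * x ^ 2) by ring.
      rewrite cos_0; ring.
Qed.

(** * Complex theta series *)

Definition csum (F : Z -> C) : C :=
  (bilateral_series (fun n => fst (F n)), bilateral_series (fun n => snd (F n))).

(** This is exp (r + i t): [r] is the logarithm of the modulus, so a product adds both arguments. *)
Definition polar (r t : R) : C := (exp r * cos t, exp r * sin t).

(** The rate is 2, twice that of [zbound], to survive a shear of the lattice: 2 |m| + 2 |k - m| >=
    |m| + |k|. *)
Definition cdec (F : Z -> C) : Prop :=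
  exists M, forall n, Rabs (fst (F n)) <= M * exp (- 2 * Rabs (IZR n)) /\
                      Rabs (snd (F n)) <= M * exp (- 2 * Rabs (IZR n)).

Lemma polar_mult (r t r' t' : R) :
  (polar r t * polar r' t')%C = polar (r + r') (t + t').
Proof.
  unfold polar, Cmult; simpl; rewrite exp_plus, cos_plus, sin_plus.
  f_equal; ring.
Qed.

Lemma polar_period (r t t' : R) (k : Z) : t = t' + 2 * PI * IZR k ->
  polar r t = polar r t'.
Proof.
  intros ->; unfold polar; f_equal; f_equal; [apply cos_2PI_add|].
  rewrite sin_plus.
  replace (2 * PI * IZR k) with (2 * (PI * IZR k)) by ring.
  rewrite sin_2a, cos_2a_sin, sin_IZR_PI; ring.
Qed.

Lemma polar_cdec (c x : R) (th : Z -> R) : 0 < c ->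
  cdec (fun n => polar (- c * (IZR n + x) ^ 2) (th n)).
Proof.
  intros Hc; destruct (exp_sq_bound c x Hc) as (M & HM & H); exists M; intros n.
  specialize (H n); unfold polar; cbn [fst snd].
  rewrite !Rabs_mult, (Rabs_pos_eq (exp _)) by (left; apply exp_pos).
  assert (h1 := Rabs_cos_le (th n)).
  assert (h2 : Rabs (sin (th n)) <= 1) by (apply Rabs_le, SIN_bound).
  assert (h3 := exp_pos (- c * (IZR n + x) ^ 2)).
  split; (eapply Rle_trans; [apply Rmult_le_compat_l; [left; exact h3 | eassumption]|]);
    rewrite Rmult_1_r; exact H.
Qed.

Lemma cdec_zdec (F : Z -> C) : cdec F ->
  zdec (fun n => fst (F n)) /\ zdec (fun n => snd (F n)).
Proof.
  intros [M H].
  assert (HM : 0 <= M).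
  { destruct (H 0%Z) as [h _]; rewrite Rabs_R0, Rmult_0_r, exp_0 in h.
    assert (h0 := Rabs_pos (fst (F 0%Z))); lra. }
  split; exists M; intros n; (eapply Rle_trans; [apply (H n)|]);
    apply Rmult_le_compat_l; try exact HM; apply exp_le;
    assert (h := Rabs_pos (IZR n)); lra.
Qed.

Lemma csum_ext (F G : Z -> C) : (forall n, F n = G n) -> csum F = csum G.
Proof. intros H; unfold csum; f_equal; apply zsum_ext; intros n; rewrite H; auto. Qed.

Lemma csum_scal (c : C) (F : Z -> C) : cdec F ->
  csum (fun n => c * F n)%C = (c * csum F)%C.
Proof.
  intros H; destruct (cdec_zdec F H) as [H1 H2].
  unfold csum, Cmult; simpl; f_equal.
  - rewrite <- !zsum_scal, <- zsum_minus by (apply zdec_scal; assumption); reflexivity.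
  - rewrite <- !zsum_scal, <- zsum_plus by (apply zdec_scal; assumption); reflexivity.
Qed.

Lemma csum_opp (F : Z -> C) : cdec F -> csum (fun n => F (- n)%Z) = csum F.
Proof.
  intros H; destruct (cdec_zdec F H) as [H1 H2]; unfold csum; f_equal.
  - rewrite <- (zsum_sub (fun n => fst (F n)) 0 H1); apply zsum_ext; intros n.
    f_equal; f_equal; lia.
  - rewrite <- (zsum_sub (fun n => snd (F n)) 0 H2); apply zsum_ext; intros n.
    f_equal; f_equal; lia.
Qed.

(** The pairs (m, n) are sorted by the parity of m + n, each class being a lattice in the rotated
    coordinates j and l. *)
Lemma zsum_rotate (g : Z -> Z -> R) (M : R) :
  (forall m n, Rabs (g m n) <= M * exp (- 2 * Rabs (IZR m)) * exp (- 2 * Rabs (IZR n))) ->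
  bilateral_series (fun m => bilateral_series (fun n => g m n))
  = bilateral_series (fun j => bilateral_series (fun l => g (j + l)%Z (j - l)%Z))
    + bilateral_series (fun j => bilateral_series (fun l => g (j + l + 1)%Z (j - l)%Z)).
Proof.
  intros H.
  assert (HM : 0 <= M).
  { specialize (H 0%Z 0%Z); rewrite Rabs_R0, Rmult_0_r, exp_0 in H.
    assert (h0 := Rabs_pos (g 0%Z 0%Z)); lra. }
  (* The rotation is a shear to k = m + n, an interchange of sums, a split by the parity of k, and a
     recentring of m. *)
  set (g' := fun m k => g m (k - m)%Z).
  assert (Hg : forall m, zdec (g m)).
  { intros m; exists (M * exp (- 2 * Rabs (IZR m))); intros n.
    eapply Rle_trans; [apply H|]; apply Rmult_le_compat_l.
    - apply Rmult_le_pos; [exact HM | left; apply exp_pos].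
    - apply exp_le; assert (h := Rabs_pos (IZR n)); lra. }
  assert (Hg' : zdec2 g').
  { exists M; intros m k; unfold g'.
    eapply Rle_trans; [apply H|].
    rewrite !Rmult_assoc, <- !exp_plus; apply Rmult_le_compat_l; [exact HM|].
    apply exp_le.
    assert (h := Rabs_triang (IZR m) (IZR (k - m))).
    rewrite minus_IZR in h |- *.
    replace (IZR m + (IZR k - IZR m)) with (IZR k) in h by ring.
    assert (h1 := Rabs_pos (IZR k - IZR m)); lra. }
  assert (Hc : forall k, zdec (fun m => g' m k)).
  { intros k; destruct (zdec2_bounds _ Hg') as (K & _ & _ & HK); eexists; apply HK. }
  transitivity (bilateral_series (fun m => bilateral_series (fun k => g' m k))).
  { apply zsum_ext; intros m; unfold g'.
    etransitivity; [symmetry; apply (zsum_add (g m) (- m) (Hg m))|].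
    apply zsum_ext; intros n; f_equal; lia. }
  rewrite zsum_swap by exact Hg'.
  rewrite zsum_split2 by (apply (zdec_zsum (fun k m => g' m k)), zdec2_swap, Hg').
  f_equal; apply zsum_ext; intros j.
  - etransitivity; [symmetry; apply (zsum_add _ j (Hc (2 * j)%Z))|].
    apply zsum_ext; intros l; unfold g'; f_equal; lia.
  - etransitivity; [symmetry; apply (zsum_add _ (j + 1) (Hc (2 * j + 1)%Z))|].
    apply zsum_ext; intros l; unfold g'; f_equal; lia.
Qed.

Lemma csum_mult_rotate (F G : Z -> C) : cdec F -> cdec G ->
  (csum F * csum G
   = csum (fun j => csum (fun l => F (j + l)%Z * G (j - l)%Z))
     + csum (fun j => csum (fun l => F (j + l + 1)%Z * G (j - l)%Z)))%C.
Proof.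
  intros HF HG.
  transitivity (csum (fun m => csum (fun n => F m * G n)%C)).
  - transitivity (csum (fun m => csum G * F m)%C).
    + rewrite csum_scal by exact HF; ring.
    + apply csum_ext; intros m; rewrite csum_scal by exact HG; ring.
  - destruct HF as [M HF], HG as [N HG].
    assert (HB : forall m n,
      Rabs (fst (F m * G n)%C) <= 2 * (M * N) * exp (- 2 * Rabs (IZR m))
                                  * exp (- 2 * Rabs (IZR n)) /\
      Rabs (snd (F m * G n)%C) <= 2 * (M * N) * exp (- 2 * Rabs (IZR m))
                                  * exp (- 2 * Rabs (IZR n))).
    { intros m n; destruct (HF m) as [f1 f2], (HG n) as [g1 g2].
      assert (P : forall u v, Rabs u <= M * exp (- 2 * Rabs (IZR m)) ->
                Rabs v <= N * exp (- 2 * Rabs (IZR n)) ->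
                Rabs (u * v) <= (M * exp (- 2 * Rabs (IZR m))) * (N * exp (- 2 * Rabs (IZR n)))).
      { intros u v hu hv; rewrite Rabs_mult.
        apply Rmult_le_compat; auto using Rabs_pos. }
      unfold Cmult; simpl fst; simpl snd; unfold Rminus.
      split; (eapply Rle_trans; [apply Rabs_triang|]); rewrite ?Rabs_Ropp.
      - assert (p1 := P _ _ f1 g1); assert (p2 := P _ _ f2 g2); lra.
      - assert (p1 := P _ _ f1 g2); assert (p2 := P _ _ f2 g1); lra. }
    unfold csum at 1; simpl fst; simpl snd; unfold Cplus; simpl fst; simpl snd.
    f_equal.
    + apply (zsum_rotate (fun m n => fst (F m * G n)%C) (2 * (M * N))).
      intros m n; apply HB.
    + apply (zsum_rotate (fun m n => snd (F m * G n)%C) (2 * (M * N))).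
      intros m n; apply HB.
Qed.

Definition gauss_cint (a b : R) : C := (gauss_int a b 0, gauss_int a b (- (PI / 2))).

(** Both components are [poisson_gauss], with eta = 0 and eta = -pi/2; the rotated integrals combine
    into a complex product. *)
Lemma poisson_complex (a b x y : R) : 0 < a ->
  let a' := a / (a ^ 2 + b ^ 2) in
  let b' := - b / (a ^ 2 + b ^ 2) in
  csum (fun n => polar (- PI * a * (IZR n + x) ^ 2)
                   (- PI * b * (IZR n + x) ^ 2 - 2 * PI * y * (IZR n + x)))
  = (gauss_cint a b
     * csum (fun k => polar (- PI * a' * (IZR k + y) ^ 2)
                        (2 * PI * IZR k * x - PI * b' * (IZR k + y) ^ 2)))%C.
Proof.
  intros Ha a' b'.
  assert (Ha' : 0 < a') by (apply Rdiv_lt_0_compat; nra).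
  assert (HP := PI_RGT_0).
  rewrite <- csum_scal.
  - unfold csum; f_equal.
    + assert (h := poisson_gauss a b x y 0 Ha); cbv zeta in h; fold a' b' in h.
      etransitivity; [|etransitivity; [exact h|]]; apply zsum_ext; intros n; simpl.
      * rewrite Rplus_0_r; reflexivity.
      * rewrite gauss_int_rot, Rplus_0_l by exact Ha; ring.
    + assert (h := poisson_gauss a b x y (- (PI / 2)) Ha); cbv zeta in h; fold a' b' in h.
      etransitivity; [|etransitivity; [exact h|]]; apply zsum_ext; intros n; simpl.
      * rewrite cos_plus, cos_neg, sin_neg, cos_PI2, sin_PI2; ring.
      * rewrite gauss_int_rot by exact Ha.
        replace (- (PI / 2) + 2 * PI * IZR n * x - PI * b' * ((IZR n + y) * ((IZR n + y) * 1)))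
          with ((2 * PI * IZR n * x - PI * b' * ((IZR n + y) * ((IZR n + y) * 1)))
                + - (PI / 2)) by ring.
        rewrite cos_plus, sin_plus, cos_neg, sin_neg, cos_PI2, sin_PI2; ring.
  - replace (- PI * a') with (- (PI * a')) by ring.
    apply polar_cdec, Rmult_lt_0_compat; assumption.
Qed.

(** * The theta values at sqrt (-7) *)

Definition theta (x : R) : R :=
  bilateral_series (fun n => exp (- (PI * sqrt 7) * (IZR n + x) ^ 2)).

(* With tau = (1 + sqrt (-7)) / 2, the terms exp (pi i tau m^2) (zterm, m = n, and
   wterm, m = n + 1/2) and exp (pi i tau m^2 / 2) (yterm, m = n + 1/2), where the
   modulus, but not the argument, is taken at a translate of m. *)
Definition zterm (r : R) (n : Z) : C :=
  polar (- (PI * sqrt 7 / 2) * (IZR n + r) ^ 2) (PI / 2 * IZR n ^ 2).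

Definition yterm (x : R) (n : Z) : C :=
  polar (- (PI * sqrt 7 / 4) * (IZR n + (x + 1 / 2)) ^ 2) (PI / 4 * (IZR n + 1 / 2) ^ 2).

Definition wterm (x : R) (n : Z) : C :=
  polar (- (PI * sqrt 7 / 2) * (IZR n + (x + 1) / 2) ^ 2) (PI / 8 * (2 * IZR n + 1) ^ 2).

Lemma sqrt7_pos : 0 < sqrt 7.
Proof. apply sqrt_lt_R0; lra. Qed.

Lemma PI_sqrt7_pos : 0 < PI * sqrt 7.
Proof. apply Rmult_lt_0_compat; [apply PI_RGT_0 | apply sqrt7_pos]. Qed.

Lemma theta_zdec (x : R) : zdec (fun n => exp (- (PI * sqrt 7) * (IZR n + x) ^ 2)).
Proof. apply exp_sq_zdec0, PI_sqrt7_pos. Qed.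

Lemma theta_pos (x : R) : 0 < theta x.
Proof.
  apply zsum_pos; [apply theta_zdec | intros; left; apply exp_pos | apply exp_pos].
Qed.

Lemma theta_opp (x : R) : theta (- x) = theta x.
Proof.
  unfold theta; rewrite <- (zsum_sub _ 0 (theta_zdec x)).
  apply zsum_ext; intros n; f_equal; rewrite minus_IZR; ring.
Qed.

Lemma theta_add (x : R) (k : Z) : theta (x + IZR k) = theta x.
Proof.
  unfold theta; rewrite <- (zsum_add _ k (theta_zdec x)).
  apply zsum_ext; intros n; f_equal; rewrite plus_IZR; ring.
Qed.

Lemma zterm_cdec (r : R) : cdec (zterm r).
Proof. assert (h := PI_sqrt7_pos); apply polar_cdec; lra. Qed.

Lemma yterm_cdec (x : R) : cdec (yterm x).
Proof. assert (h := PI_sqrt7_pos); apply polar_cdec; lra. Qed.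

Lemma wterm_cdec (x : R) : cdec (wterm x).
Proof. assert (h := PI_sqrt7_pos); apply polar_cdec; lra. Qed.

Lemma cconj_csum (F : Z -> C) : Cconj (csum F) = csum (fun n => Cconj (F n)).
Proof.
  unfold csum, Cconj; simpl; f_equal.
  replace (- bilateral_series (fun n => snd (F n)))
    with ((- (1)) * bilateral_series (fun n => snd (F n))) by ring.
  rewrite <- zsum_scal; apply zsum_ext; intros n; ring.
Qed.

(** For m = j + l, n = j - l the phase (pi/2)(m^2 - n^2) is 2 pi j l, hence trivial. In the other
    class m^2 - n^2 = (2j + 1)(2l + 1) is odd, so those terms are imaginary and the real part
    removes them. *)
Lemma theta_mult (x y : R) :
  theta x * theta y
  = fst (csum (zterm (x + y)) * Cconj (csum (zterm (x - y))))%C.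
Proof.
  rewrite cconj_csum.
  assert (Hc : forall n, Cconj (zterm (x - y) n)
     = polar (- (PI * sqrt 7 / 2) * (IZR n + (x - y)) ^ 2) (- (PI / 2 * IZR n ^ 2))).
  { intros n; unfold Cconj, zterm, polar; cbn [fst snd].
    rewrite cos_neg, sin_neg; f_equal; ring. }
  rewrite csum_mult_rotate.
  2: apply zterm_cdec.
  2: { destruct (zterm_cdec (x - y)) as [M H]; exists M; intros n.
       unfold Cconj; cbn [fst snd]; rewrite Rabs_Ropp; apply H. }
  unfold csum, Cplus; cbn [fst].
  set (S2 := bilateral_series (fun j => bilateral_series (fun l =>
     fst (zterm (x + y) (j + l + 1)%Z * Cconj (zterm (x - y) (j - l)%Z))%C))).
  assert (E2 : S2 = 0).
  { unfold S2; rewrite <- zsum_0; apply zsum_ext; intros j.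
    rewrite <- zsum_0; apply zsum_ext; intros l.
    rewrite Hc; unfold zterm; rewrite polar_mult; unfold polar; cbn [fst].
    replace (PI / 2 * IZR (j + l + 1) ^ 2 + - (PI / 2 * IZR (j - l) ^ 2))
      with (PI * IZR (2 * j * l + j + l) + PI / 2).
    - rewrite cos_add_PI2, sin_IZR_PI; ring.
    - rewrite !plus_IZR, minus_IZR, !mult_IZR; field. }
  change (theta x * theta y =
    bilateral_series (fun j => bilateral_series (fun l =>
     fst (zterm (x + y) (j + l)%Z * Cconj (zterm (x - y) (j - l)%Z))%C)) + S2).
  rewrite E2, Rplus_0_r.
  unfold theta at 1; rewrite Rmult_comm, <- zsum_scal.
  apply zsum_ext; intros j; rewrite Rmult_comm.
  unfold theta; rewrite <- zsum_scal; apply zsum_ext; intros l.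
  rewrite Hc; unfold zterm; rewrite polar_mult.
  rewrite (polar_period _ _ 0 (j * l)).
  - unfold polar; cbn [fst]; rewrite cos_0, Rmult_1_r, <- exp_plus.
    f_equal; rewrite plus_IZR, minus_IZR; field.
  - rewrite plus_IZR, minus_IZR, mult_IZR; field.
Qed.

(** Both parity classes factor into the same product, with the roles of j and l exchanged; hence the
    2. *)
Lemma landen (x : R) :
  (csum (yterm x) * csum (yterm 0) = 2 * (csum (wterm x) * csum (zterm (x / 2))))%C.
Proof.
  rewrite csum_mult_rotate by apply yterm_cdec.
  assert (E1 : csum (fun j => csum (fun l => yterm x (j + l)%Z * yterm 0 (j - l)%Z)%C)
               = (csum (wterm x) * csum (zterm (x / 2)))%C).
  { transitivity (csum (fun j => csum (zterm (x / 2)) * wterm x j)%C).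
    - apply csum_ext; intros j; rewrite Cmult_comm, <- csum_scal by apply zterm_cdec.
      apply csum_ext; intros l; unfold yterm, wterm, zterm; rewrite !polar_mult.
      rewrite plus_IZR, minus_IZR; f_equal; field.
    - rewrite csum_scal by apply wterm_cdec; apply Cmult_comm. }
  assert (E2 : csum (fun j => csum (fun l => yterm x (j + l + 1)%Z * yterm 0 (j - l)%Z)%C)
               = (csum (wterm x) * csum (zterm (x / 2)))%C).
  { transitivity (csum (fun j => csum (wterm x) * zterm (x / 2) (j + 1)%Z)%C).
    - apply csum_ext; intros j; rewrite Cmult_comm, <- csum_scal by apply wterm_cdec.
      apply csum_ext; intros l; unfold yterm, wterm, zterm; rewrite !polar_mult.
      rewrite !plus_IZR, minus_IZR; f_equal; field.
    - destruct (cdec_zdec _ (zterm_cdec (x / 2))) as [h1 h2].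
      rewrite csum_scal.
      + f_equal; unfold csum; f_equal.
        * exact (zsum_add _ 1 h1).
        * exact (zsum_add _ 1 h2).
      + assert (h := PI_sqrt7_pos).
        destruct (polar_cdec (PI * sqrt 7 / 2) (x / 2 + 1)
                    (fun n => PI / 2 * IZR (n + 1) ^ 2)) as [M HM]; [lra|].
        exists M; intros n; unfold zterm; specialize (HM n).
        replace (IZR (n + 1) + x / 2) with (IZR n + (x / 2 + 1))
          by (rewrite plus_IZR; ring); exact HM. }
  rewrite E1, E2; ring.
Qed.

(** As (2n + 1)^2 = 1 + 4 n (n + 1) with n (n + 1) even, all terms have the argument pi/8 up to
    sign, whatever [x] is. *)
Lemma wterm_phase (x : R) : exists w : R, csum (wterm x) = (polar 0 (PI / 8) * RtoC w)%C.
Proof.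
  set (g := fun n => exp (- (PI * sqrt 7 / 2) * (IZR n + (x + 1) / 2) ^ 2)
                     * cos (PI / 2 * (IZR n * (IZR n + 1)))).
  exists (bilateral_series g).
  assert (Hw : forall n, wterm x n = (polar 0 (PI / 8) * RtoC (g n))%C).
  { intros n.
    assert (Hr : RtoC (g n) = polar (- (PI * sqrt 7 / 2) * (IZR n + (x + 1) / 2) ^ 2)
                                (PI / 2 * (IZR n * (IZR n + 1)))).
    { unfold polar, g, RtoC; f_equal.
      destruct (Z.Even_or_Odd (n * (n + 1))) as [[k Hk]|[k Hk]].
      - replace (IZR n * (IZR n + 1)) with (IZR (n * (n + 1)))
          by (rewrite mult_IZR, plus_IZR; reflexivity).
        rewrite Hk, mult_IZR.
        replace (PI / 2 * (2 * IZR k)) with (PI * IZR k) by field.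
        rewrite sin_IZR_PI; ring.
      - exfalso; destruct (Z.Even_or_Odd n) as [[m Hm]|[m Hm]]; subst n; lia. }
    rewrite Hr, polar_mult; unfold wterm; f_equal; field. }
  rewrite (csum_ext _ _ Hw).
  rewrite csum_scal.
  - f_equal; unfold csum, RtoC; simpl; f_equal; apply zsum_0.
  - assert (h := PI_sqrt7_pos).
    destruct (exp_sq_bound (PI * sqrt 7 / 2) ((x + 1) / 2)) as (M & HM & H); [lra|].
    exists M; intros n; unfold RtoC; cbn [fst snd]; rewrite Rabs_R0; split.
    + unfold g; rewrite Rabs_mult, (Rabs_pos_eq (exp _)) by (left; apply exp_pos).
      eapply Rle_trans; [apply Rmult_le_compat_l; [left; apply exp_pos | apply Rabs_cos_le]|].
      rewrite Rmult_1_r; apply H.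
    + apply Rmult_le_pos; [exact HM | left; apply exp_pos].
Qed.

(** The Gaussian parameter (sqrt 7 + i) / 2 has squared modulus 2, so its inverse is half its
    conjugate: the dual series has the parameter (sqrt 7 - i) / 4 of [yterm]. *)
Lemma zterm_poisson (s : Z) :
  csum (zterm (8 * IZR s / 7))
  = (gauss_cint (sqrt 7 / 2) (1 / 2)
     * (polar 0 (- PI * IZR s - 4 * PI * IZR s ^ 2 / 7)
        * csum (yterm (4 * IZR s / 7))))%C.
Proof.
  assert (h7 := sqrt7_pos); assert (h := PI_sqrt7_pos).
  assert (hs : sqrt 7 ^ 2 = 7) by (apply pow2_sqrt; lra).
  set (r := 8 * IZR s / 7).
  (* In y = -(r + 1)/2 the part -r/2 cancels the cross term in r n, so that the phase depends on n
     alone, and -1/2 contributes the sign (-1)^n that turns (-i)^(n^2) into i^(n^2). *)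
  set (F := fun n => polar (- PI * (sqrt 7 / 2) * (IZR n + r) ^ 2)
     (- PI * (1 / 2) * (IZR n + r) ^ 2 - 2 * PI * (- (r + 1) / 2) * (IZR n + r))).
  set (G := fun k => polar (- PI * (sqrt 7 / 4) * (IZR k + - (r + 1) / 2) ^ 2)
     (2 * PI * IZR k * r - PI * (- (1) / 4) * (IZR k + - (r + 1) / 2) ^ 2)).
  assert (HF : cdec F).
  { unfold F; replace (- PI * (sqrt 7 / 2)) with (- (PI * sqrt 7 / 2)) by field.
    apply polar_cdec; lra. }
  assert (HG : cdec G).
  { unfold G; replace (- PI * (sqrt 7 / 4)) with (- (PI * sqrt 7 / 4)) by field.
    apply polar_cdec; lra. }
  assert (HFG : csum F = (gauss_cint (sqrt 7 / 2) (1 / 2) * csum G)%C).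
  { unfold F; rewrite poisson_complex by lra.
    replace ((sqrt 7 / 2) ^ 2 + (1 / 2) ^ 2) with 2
      by (replace ((sqrt 7 / 2) ^ 2) with (sqrt 7 ^ 2 / 4) by field; rewrite hs; field).
    f_equal; apply csum_ext; intros k; unfold G; f_equal; field. }
  transitivity (polar 0 (- PI * r ^ 2 / 2 - PI * r) * csum F)%C.
  - rewrite <- csum_scal by exact HF; apply csum_ext; intros n; unfold F, zterm.
    rewrite polar_mult, Rplus_0_l.
    assert (He : exists k, IZR n * (IZR n - 1) = 2 * IZR k).
    { destruct (Z.Even_or_Odd (n * (n - 1))) as [[k Hk]|[k Hk]].
      - exists k; rewrite <- minus_IZR, <- !mult_IZR; f_equal; exact Hk.
      - exfalso; destruct (Z.Even_or_Odd n) as [[m Hm]|[m Hm]]; subst n; lia. }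
    destruct He as [k Hk].
    replace (- (PI * sqrt 7 / 2)) with (- PI * (sqrt 7 / 2)) by field.
    apply polar_period with k.
    replace (2 * PI * IZR k) with (PI * (IZR n * (IZR n - 1))) by (rewrite Hk; ring).
    field.
  - rewrite HFG.
    transitivity (gauss_cint (sqrt 7 / 2) (1 / 2)
       * (polar 0 (- PI * r ^ 2 / 2 - PI * r) * csum G))%C; [ring|].
    f_equal.
    rewrite <- (csum_opp G HG), <- !csum_scal.
    + apply csum_ext; intros n; unfold G, yterm; rewrite !polar_mult, opp_IZR.
      replace (0 + - (PI * sqrt 7 / 4) * (IZR n + (4 * IZR s / 7 + 1 / 2)) ^ 2)
        with (0 + - PI * (sqrt 7 / 4) * (- IZR n + - (r + 1) / 2) ^ 2)
        by (unfold r; field).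
      (* The surplus cross phase is -(7/4) pi r n, which is -2 pi s n for r = 8s/7; this dictates
         the division point. *)
      apply polar_period with (- (n * s))%Z.
      rewrite opp_IZR, mult_IZR; unfold r; field.
    + apply yterm_cdec.
    + destruct HG as [M HM]; exists M; intros n; specialize (HM (- n)%Z).
      rewrite opp_IZR, Rabs_Ropp in HM; exact HM.
Qed.

Lemma zterm_norm (x : R) :
  fst (csum (zterm x)) ^ 2 + snd (csum (zterm x)) ^ 2 = theta x * theta 0.
Proof.
  rewrite theta_mult, Rplus_0_r, Rminus_0_r.
  unfold Cconj, Cmult; cbn [fst snd]; ring.
Qed.

(* The endomorphism (1 + sqrt (-7)) / 2 of norm 2 acts on the kernel of
   sqrt (-7) as multiplication by 4. *)
Lemma zterm_cm (s : Z) : exists c : R,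
  csum (zterm (8 * IZR s / 7))
  = (polar 0 (- PI * IZR s - 4 * PI * IZR s ^ 2 / 7)
     * (RtoC c * csum (zterm (2 * IZR s / 7))))%C.
Proof.
  assert (Hz : csum (zterm 0) <> 0%C).
  { intros e; assert (h := zterm_norm 0); rewrite e in h; simpl in h.
    assert (h0 := theta_pos 0); nra. }
  set (k := gauss_cint (sqrt 7 / 2) (1 / 2)).
  assert (P0 : csum (zterm 0) = (k * csum (yterm 0))%C).
  { assert (h := zterm_poisson 0); fold k in h.
    replace (8 * 0 / 7) with 0 in h by field; replace (4 * 0 / 7) with 0 in h by field.
    replace (- PI * 0 - 4 * PI * 0 ^ 2 / 7) with 0 in h by field.
    rewrite h; unfold polar; rewrite exp_0, cos_0, sin_0.
    f_equal; destruct (csum (yterm 0)) as [u v]; unfold Cmult; simpl; f_equal; ring. }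
  assert (Hy : csum (yterm 0) <> 0%C).
  { intros e; apply Hz; rewrite P0, e; ring. }
  destruct (wterm_phase 0) as [w0 Hw0].
  destruct (wterm_phase (4 * IZR s / 7)) as [w Hw].
  assert (L0 := landen 0); rewrite Hw0 in L0.
  replace (0 / 2) with 0 in L0 by field.
  assert (L := landen (4 * IZR s / 7)); rewrite Hw in L.
  replace (4 * IZR s / 7 / 2) with (2 * IZR s / 7) in L by field.
  set (Y := csum (yterm 0)) in *; set (e8 := polar 0 (PI / 8)) in *.
  (* Poisson and Landen at the point 0 give Y^2 = 2 e8 w0 k Y; cancelling Y ties the Gaussian
     integral [k] to Y. *)
  assert (K : (Y = 2 * (e8 * RtoC w0) * k)%C).
  { rewrite P0 in L0.
    assert (L1 : (Y * (Y - 2 * (e8 * RtoC w0) * k) = 0)%C).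
    { transitivity (Y * Y - 2 * (e8 * RtoC w0 * (k * Y)))%C; [ring|].
      rewrite <- L0; ring. }
    destruct (Ceq_dec (Y - 2 * (e8 * RtoC w0) * k)%C 0%C) as [e|e].
    - replace Y with ((Y - 2 * (e8 * RtoC w0) * k) + 2 * (e8 * RtoC w0) * k)%C by ring.
      rewrite e; ring.
    - exfalso; exact (Cmult_neq_0 _ _ Hy e L1). }
  assert (Hw0' : RtoC w0 <> 0%C).
  { intros e; apply Hy; rewrite K, e; ring. }
  (* The same two formulas at the division point differ only by [w] in place of [w0]; the common
     phase e8 and [k] cancel, leaving a real quotient. *)
  exists (w / w0); rewrite zterm_poisson; fold k.
  assert (Hw0r : w0 <> 0) by (intros e; apply Hw0'; rewrite e; reflexivity).
  rewrite RtoC_div by exact Hw0r.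
  set (Z2 := csum (zterm (2 * IZR s / 7))) in *.
  set (Y4 := csum (yterm (4 * IZR s / 7))) in *.
  assert (H1 : (Y * (k * Y4) = Y * (RtoC w / RtoC w0 * Z2))%C).
  { transitivity (k * (Y4 * Y))%C; [ring|]; rewrite L, K; field; exact Hw0'. }
  assert (H2 : (k * Y4 = RtoC w / RtoC w0 * Z2)%C).
  { transitivity (/ Y * (Y * (k * Y4)))%C; [field; exact Hy|].
    rewrite H1; field; split; assumption. }
  rewrite <- H2; ring.
Qed.

(** With t the angle in the cosine, [zterm_cm] makes the product in [theta_mult] have real part c
    cos t |z(2s/7)|^2. In its square, c^2 |z(2s/7)|^2 is |z(8s/7)|^2, so neither c nor its sign
    remains. *)
Lemma theta_relation (s : Z) :
  (theta (5 * IZR s / 7) * theta (3 * IZR s / 7)) ^ 2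
  = cos (PI * IZR s + 4 * PI * IZR s ^ 2 / 7) ^ 2
    * (theta (8 * IZR s / 7) * theta (2 * IZR s / 7) * theta 0 ^ 2).
Proof.
  rewrite theta_mult.
  replace (5 * IZR s / 7 + 3 * IZR s / 7) with (8 * IZR s / 7) by field.
  replace (5 * IZR s / 7 - 3 * IZR s / 7) with (2 * IZR s / 7) by field.
  transitivity (cos (PI * IZR s + 4 * PI * IZR s ^ 2 / 7) ^ 2
    * ((theta (8 * IZR s / 7) * theta 0) * (theta (2 * IZR s / 7) * theta 0))); [|ring].
  rewrite <- !zterm_norm; destruct (zterm_cm s) as [c ->].
  destruct (csum (zterm (2 * IZR s / 7))) as [u v].
  replace (- PI * IZR s - 4 * PI * IZR s ^ 2 / 7)
    with (- (PI * IZR s + 4 * PI * IZR s ^ 2 / 7)) by field.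
  set (t := PI * IZR s + 4 * PI * IZR s ^ 2 / 7).
  assert (Ht := sin2_cos2 t); unfold Rsqr in Ht.
  unfold polar, RtoC, Cconj, Cmult; cbn [fst snd]; rewrite exp_0, cos_neg, sin_neg.
  transitivity (cos t ^ 2 * (c ^ 2 * (u ^ 2 + v ^ 2) * (sin t * sin t + cos t * cos t)
                             * (u ^ 2 + v ^ 2))); [rewrite Ht; ring | ring].
Qed.

(** * The inversion formula at the nome exp (- 7 pi sqrt 7) *)

Lemma varphi_exp (c : R) :
  varphi (exp (- c)) = bilateral_series (fun n => exp (- c * IZR n ^ 2)).
Proof.
  apply zsum_ext; intros n.
  rewrite <- (Z2Nat.id (n ^ 2)) by nia.
  rewrite <- pow_powerRZ.
  assert (e : forall m, exp (- c) ^ m = exp (- c * INR m)).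
  { induction m as [|m IH]; [simpl; rewrite Rmult_0_r, exp_0; reflexivity|].
    rewrite S_INR; simpl; rewrite IH, <- exp_plus; f_equal; ring. }
  rewrite e, INR_IZR_INZ, Z2Nat.id by nia; f_equal; f_equal.
  rewrite Z.pow_2_r, mult_IZR; ring.
Qed.

Lemma varphi_septic :
  varphi (exp (- (7 * PI * sqrt 7)))
  = Rpower 7 (- (3 / 4))
    * (theta 0 + 2 * theta (1 / 7) + 2 * theta (2 / 7) + 2 * theta (3 / 7)).
Proof.
  assert (h7 := sqrt7_pos); assert (HP := PI_RGT_0).
  assert (hs : sqrt 7 * sqrt 7 = 7) by (apply sqrt_sqrt; lra).
  assert (h1 : 1 <= sqrt 7) by (rewrite <- sqrt_1; apply sqrt_le_1_alt; lra).
  rewrite varphi_exp.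
  rewrite (zsum_ext _ (fun n => exp (- PI * (7 * sqrt 7) * IZR n ^ 2)))
    by (intros n; f_equal; ring).
  rewrite poisson_real by lra.
  set (f := fun n => exp (- PI * / (7 * sqrt 7) * IZR n ^ 2)).
  assert (Hf : zdec f).
  { apply (zdec_ext (fun n => exp (- (PI * / (7 * sqrt 7)) * (IZR n + 0) ^ 2))).
    - intros n; unfold f; f_equal; ring.
    - apply exp_sq_zdec0, Rmult_lt_0_compat; [lra | apply Rinv_0_lt_compat; lra]. }
  (* Residues modulo 7 produce the division points: (7n + j)^2 / (7 sqrt 7) = sqrt 7 (n + j/7)^2. *)
  assert (Hj : forall j : nat, bilateral_series (fun n => f (Z.of_nat 7 * n + Z.of_nat j)%Z)
                               = theta (INR j / 7)).
  { intros j; apply zsum_ext; intros n; unfold f; f_equal.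
    rewrite plus_IZR, mult_IZR, <- !INR_IZR_INZ; simpl (INR 7).
    replace (1 + 1 + 1 + 1 + 1 + 1 + 1) with 7 by ring.
    replace (- (PI * sqrt 7)) with (- PI * / (7 * sqrt 7) * 49).
    - field; lra.
    - replace 49 with (7 * (sqrt 7 * sqrt 7)) by (rewrite hs; ring). field; lra. }
  rewrite (zsum_split f 6 Hf), !sum_Sn, sum_O, !Hj; change plus with Rplus.
  assert (Hr : forall k : Z, theta (1 - IZR k / 7) = theta (IZR k / 7)).
  { intros k; rewrite <- theta_opp, <- (theta_add _ 1); f_equal; simpl; ring. }
  assert (t4 := Hr 3%Z); assert (t5 := Hr 2%Z); assert (t6 := Hr 1%Z).
  replace (1 - 3 / 7) with (4 / 7) in t4 by field.
  replace (1 - 2 / 7) with (5 / 7) in t5 by field.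
  replace (1 - 1 / 7) with (6 / 7) in t6 by field.
  simpl INR.
  replace (0 / 7) with 0 by field.
  replace (1 + 1 + 1 + 1 + 1 + 1) with 6 by ring.
  replace (1 + 1 + 1 + 1 + 1) with 5 by ring.
  replace (1 + 1 + 1 + 1) with 4 by ring.
  replace (1 + 1 + 1) with 3 by ring.
  replace (1 + 1) with 2 by ring.
  rewrite t4, t5, t6.
  assert (Hk : gauss_int (7 * sqrt 7) 0 0 = Rpower 7 (- (3 / 4))).
  { assert (hk := gauss_int_real (7 * sqrt 7) ltac:(lra)).
    assert (e : sqrt (7 * sqrt 7) = Rpower 7 (3 / 4)).
    { rewrite <- (Rpower_sqrt 7) by lra.
      replace (7 * Rpower 7 (/ 2)) with (Rpower 7 (3 / 2)).
      - rewrite <- Rpower_sqrt by apply exp_pos; rewrite Rpower_mult; f_equal; field.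
      - replace (3 / 2) with (1 + / 2) by field.
        rewrite Rpower_plus, Rpower_1 by lra; reflexivity. }
    rewrite e in hk; rewrite Rpower_Ropp.
    assert (hp : 0 < Rpower 7 (3 / 4)) by apply exp_pos.
    apply (Rmult_eq_reg_l (Rpower 7 (3 / 4))); [|lra].
    rewrite hk; field; lra. }
  rewrite Hk; ring.
Qed.

(** * Cosines of multiples of pi/7 and the cyclic system *)

Lemma cos_prod_7 : cos (PI / 7) * cos (2 * PI / 7) * cos (3 * PI / 7) = 1 / 8.
Proof.
  assert (HP := PI_RGT_0).
  assert (hs : 0 < sin (PI / 7)) by (apply sin_gt_0; lra).
  assert (h3 : cos (3 * PI / 7) = - cos (2 * (2 * (PI / 7)))).
  { rewrite <- Rtrigo_facts.cos_pi_minus; f_equal; field. }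
  assert (h8 : sin (2 * (2 * (2 * (PI / 7)))) = - sin (PI / 7)).
  { replace (2 * (2 * (2 * (PI / 7)))) with (PI / 7 + PI) by field; apply neg_sin. }
  replace (2 * PI / 7) with (2 * (PI / 7)) by field; rewrite h3.
  (* Doubling three times gives 8 sin x cos x cos 2x cos 4x = sin 8x = - sin x. *)
  set (x := PI / 7) in *.
  rewrite !sin_2a in h8.
  apply (Rmult_eq_reg_l (8 * sin x)); [|lra]. lra.
Qed.

Lemma ln_sqr (x : R) : 0 < x -> ln (x ^ 2) = 2 * ln x.
Proof. intros H; simpl; rewrite Rmult_1_r, ln_mult by assumption; ring. Qed.

(** In logarithms the matrix has determinant 14, and ln u = (7 ln 2 + 5 ln c2 + 3 ln c1 - ln c3) /
    7. Three times the logarithm of 8 c1 c2 c3 = 1 removes c1 and leaves the exponent 2/7. *)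
Lemma cyclic_system (u v w c1 c2 c3 : R) :
  0 < u -> 0 < v -> 0 < w -> 0 < c1 -> 0 < c2 -> 0 < c3 ->
  8 * (c1 * c2 * c3) = 1 ->
  u ^ 2 * w = (2 * c2) ^ 2 * v -> u * v ^ 2 = (2 * c1) ^ 2 * w ->
  v * w ^ 2 = (2 * c3) ^ 2 * u ->
  u = Rpower (c2 / (2 * c3 ^ 2)) (2 / 7).
Proof.
  intros Hu Hv Hw H1 H2 H3 Hc E1 E2 E3.
  assert (P : forall x, 0 < x -> 0 < x ^ 2) by (intros; apply pow_lt; assumption).
  assert (l1 := f_equal ln E1); assert (l2 := f_equal ln E2); assert (l3 := f_equal ln E3).
  assert (l4 := f_equal ln Hc); rewrite ln_1 in l4.
  rewrite !ln_mult, !ln_sqr, !ln_mult in l1 by (try apply P; lra).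
  rewrite !ln_mult, !ln_sqr, !ln_mult in l2 by (try apply P; lra).
  rewrite !ln_mult, !ln_sqr, !ln_mult in l3 by (try apply P; lra).
  replace 8 with (2 ^ 2 * 2) in l4 by ring.
  rewrite !ln_mult, !ln_sqr in l4
    by (repeat apply Rmult_lt_0_compat; try apply P; lra).
  apply ln_inv; [exact Hu | apply exp_pos|].
  unfold Rpower; rewrite ln_exp, ln_div, ln_mult, ln_sqr
    by (try apply Rmult_lt_0_compat; try apply P; lra).
  lra.
Qed.

(** The factor [b] common to both sides cancels. The unknowns are 2 T_r / T_0, the terms of the
    final sum, which turns k into 2 k. *)
Lemma theta_cyclic (a b c t0 k : R) : 0 < a -> 0 < b -> 0 < t0 ->
  (a * b) ^ 2 = k ^ 2 * (b * c * t0 ^ 2) ->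
  (2 * b / t0) * (2 * a / t0) ^ 2 = (2 * k) ^ 2 * (2 * c / t0).
Proof.
  intros Ha Hb Ht H.
  apply (Rmult_eq_reg_l (b * t0 ^ 3)).
  - transitivity (8 * (a * b) ^ 2); [field; lra|]; rewrite H; field; lra.
  - apply Rgt_not_eq, Rmult_lt_0_compat; [exact Hb | apply pow_lt, Ht].
Qed.

Lemma theta_congr (x y : R) (k : Z) : x = y + IZR k \/ x = - y + IZR k -> theta x = theta y.
Proof.
  intros [-> | ->]; rewrite theta_add; [reflexivity | apply theta_opp].
Qed.

Lemma cos_sqr_congr (x y : R) (k : Z) : x = y + PI * IZR k \/ x = - y + PI * IZR k ->
  cos x ^ 2 = cos y ^ 2.
Proof.
  assert (h := sin2_cos2 (PI * IZR k)); rewrite sin_IZR_PI in h; unfold Rsqr in h.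
  intros [-> | ->]; rewrite cos_plus, sin_IZR_PI, ?cos_neg;
    transitivity (cos y ^ 2 * (0 * 0 + cos (PI * IZR k) * cos (PI * IZR k)));
    try ring; rewrite h; ring.
Qed.

Theorem theorem4p1 :
  varphi (exp (- (7 * PI * sqrt 7))) =
  Rpower 7 (- (3 / 4)) * varphi (exp (- (PI * sqrt 7))) *
  (1 + Rpower (cos (PI / 7) / (2 * cos (2 * PI / 7) ^ 2)) (2 / 7)
     + Rpower (cos (2 * PI / 7) / (2 * cos (3 * PI / 7) ^ 2)) (2 / 7)
     + Rpower (cos (3 * PI / 7) / (2 * cos (PI / 7) ^ 2)) (2 / 7)).
Proof.
  assert (HP := PI_RGT_0).
  rewrite varphi_septic.
  assert (H0 : varphi (exp (- (PI * sqrt 7))) = theta 0).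
  { rewrite varphi_exp; apply zsum_ext; intros n; rewrite Rplus_0_r; reflexivity. }
  rewrite H0.
  (* Theta values depend on the argument modulo 1 and sign, squared cosines on the angle modulo pi
     and sign: 11 pi/7, 30 pi/7 and 57 pi/7 reduce to 3 pi/7, 2 pi/7 and pi/7. *)
  assert (R1 := theta_relation 1); assert (R2 := theta_relation 2);
    assert (R3 := theta_relation 3).
  rewrite (theta_congr (5 * 1 / 7) (2 / 7) 1), (theta_congr (8 * 1 / 7) (1 / 7) 1),
    (cos_sqr_congr _ (3 * PI / 7) 2) in R1 by (simpl; lra).
  rewrite (theta_congr (5 * 2 / 7) (3 / 7) 1), (theta_congr (3 * 2 / 7) (1 / 7) 1),
    (theta_congr (8 * 2 / 7) (2 / 7) 2), (theta_congr (2 * 2 / 7) (3 / 7) 1),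
    (cos_sqr_congr _ (2 * PI / 7) 4) in R2 by (simpl; lra).
  rewrite (theta_congr (5 * 3 / 7) (1 / 7) 2), (theta_congr (3 * 3 / 7) (2 / 7) 1),
    (theta_congr (8 * 3 / 7) (3 / 7) 3), (theta_congr (2 * 3 / 7) (1 / 7) 1),
    (cos_sqr_congr _ (PI / 7) 8) in R3 by (simpl; lra).
  assert (p0 := theta_pos 0); assert (p1 := theta_pos (1 / 7)).
  assert (p2 := theta_pos (2 / 7)); assert (p3 := theta_pos (3 / 7)).
  replace (3 * 1 / 7) with (3 / 7) in R1 by field.
  replace (2 * 1 / 7) with (2 / 7) in R1 by field.
  set (t0 := theta 0) in *; set (t1 := theta (1 / 7)) in *;
    set (t2 := theta (2 / 7)) in *; set (t3 := theta (3 / 7)) in *.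
  assert (hc := cos_prod_7).
  assert (k1 : 0 < cos (PI / 7)) by (apply cos_gt_0; lra).
  assert (k2 : 0 < cos (2 * PI / 7)) by (apply cos_gt_0; lra).
  assert (k3 : 0 < cos (3 * PI / 7)) by (apply cos_gt_0; lra).
  set (c1 := cos (PI / 7)) in *; set (c2 := cos (2 * PI / 7)) in *;
    set (c3 := cos (3 * PI / 7)) in *.
  assert (E1 := theta_cyclic t1 t3 t2 t0 c2 p1 p3 p0 ltac:(lra)).
  assert (E2 := theta_cyclic t2 t1 t3 t0 c1 p2 p1 p0 ltac:(lra)).
  assert (E3 := theta_cyclic t3 t2 t1 t0 c3 p3 p2 p0 ltac:(lra)).
  assert (q : forall t, 0 < t -> 0 < 2 * t / t0).
  { intros t Ht; apply Rdiv_lt_0_compat; lra. }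
  apply q in p1; apply q in p2; apply q in p3.
  (* The system is invariant under t1 -> t2 -> t3 -> t1 together with c1 -> c3 -> c2 -> c1, so one
     formula gives all three powers. In the order of the statement they are the terms of T_2, T_1
     and T_3. *)
  rewrite <- (cyclic_system (2 * t1 / t0) (2 * t2 / t0) (2 * t3 / t0) c1 c2 c3) by lra.
  rewrite <- (cyclic_system (2 * t2 / t0) (2 * t3 / t0) (2 * t1 / t0) c3 c1 c2) by lra.
  rewrite <- (cyclic_system (2 * t3 / t0) (2 * t1 / t0) (2 * t2 / t0) c2 c3 c1) by lra.
  field; lra.
Qed.
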